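(* If $\mathcal{I}_{Lip}^{1}$ and $\mathcal{I}_{Lip}^{2}$ are injective Lipschitz operator ideals, then $[\mathcal{I}_{Lip}^{1},\mathcal{I}_{Lip}^{2}]$ is an injective two-Lipschitz operator ideal.
   Context: Let $\mathbb{K}$ be $\mathbb{R}$ or $\mathbb{C}$; all Banach spaces are over $\mathbb{K}$. A pointed metric space is a metric space with a distinguished base point $0$. $Lip_0(X,Y)$ is the set of Lipschitz maps $T:X\to Y$ with $T(0)=0$ and $Lip(T)$ is the least Lipschitz constant; for a Banach space $E$, $Lip_0(X,E)$ is a Banach space under $Lip(\cdot)$; $X^{\#}=Lip_0(X,\mathbb{K})$. $\mathcal{L}(E,F)$ is the space of bounded linear operators. A map $T:X_1\times X_2\to E$ belongs to $BLip_0(X_1,X_2;E)$ if $T(x_1,0)=T(0,x_2)=0$ for all $x_1,x_2$ and there is $C>0$ with $\|T(x_1,x_2)-T(x_1,x_2')-T(x_1',x_2)+T(x_1',x_2')\|\le C\,d(x_1,x_1')d(x_2,x_2')$ for all $x_1,x_1'\in X_1$, $x_2,x_2'\in X_2$. The least such $C$ is the norm $BLip(T)$. A Lipschitz operator ideal $\mathcal{I}_{Lip}$ is a subclass of $Lip_0$ such that for every pointed metric space $X$ and Banach space $E$ the components $\mathcal{I}_{Lip}(X,E):=Lip_0(X,E)\cap\mathcal{I}_{Lip}$ satisfy: (i) $\mathcal{I}_{Lip}(X,E)$ is a linear subspace of $Lip_0(X,E)$; (ii) $vg:x\mapsto g(x)v$ belongs to $\mathcal{I}_{Lip}(X,E)$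 for $v\in E$, $g\in X^{\#}$; (iii) if $S\in Lip_0(Y,X)$, $T\in\mathcal{I}_{Lip}(X,E)$, $w\in\mathcal{L}(E,F)$, then $wTS\in\mathcal{I}_{Lip}(Y,F)$. It is normed if there is $\|\cdot\|_{\mathcal{I}_{Lip}}:\mathcal{I}_{Lip}\to[0,\infty)$ such that each $(\mathcal{I}_{Lip}(X,E),\|\cdot\|_{\mathcal{I}_{Lip}})$ is a normed space with $Lip(T)\le\|T\|_{\mathcal{I}_{Lip}}$; $\|Id_{\mathbb{K}}\|_{\mathcal{I}_{Lip}}=1$; and $\|wTS\|_{\mathcal{I}_{Lip}}\le Lip(S)\|T\|_{\mathcal{I}_{Lip}}\|w\|$. A two-Lipschitz operator ideal $\mathcal{I}_{BLip}$ is a subclass of $BLip_0$ whose components $\mathcal{I}_{BLip}(X_1,X_2;E)$ are linear subspaces of $BLip_0(X_1,X_2;E)$, contain all maps $(x_1,x_2)\mapsto f_1(x_1)f_2(x_2)e$ with $f_j\in X_j^{\#}$, $e\in E$, and satisfy $u\circ T\circ(f_1,f_2)\in\mathcal{I}_{BLip}(Z,W;F)$ whenever $f_1\in Lip_0(Z,X_1)$, $f_2\in Lip_0(W,X_2)$, $T\in\mathcal{I}_{BLip}(X_1,X_2;E)$, $u\in\mathcal{L}(E,F)$. Each $T\in BLip_0(X_1,X_2;E)$ has associated maps $T_1\in Lip_0(X_1,Lip_0(X_2,E))$ and $T_2\in Lip_0(X_2,Lip_0(X_1,E))$, $T_1(x_1)(x_2)=T(x_1,x_2)=T_2(x_2)(x_1)$.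 $T\in[\mathcal{I}_{Lip}^{1},\mathcal{I}_{Lip}^{2}](X_1,X_2;E)$ iff $T_1\in\mathcal{I}_{Lip}^{1}(X_1,Lip_0(X_2,E))$ and $T_2\in\mathcal{I}_{Lip}^{2}(X_2,Lip_0(X_1,E))$; in the normed case $\|T\|_{[\mathcal{I}_{Lip}^{1},\mathcal{I}_{Lip}^{2}]}=\max\{\|T_1\|_{\mathcal{I}_{Lip}^{1}},\|T_2\|_{\mathcal{I}_{Lip}^{2}}\}$. Injectivity: for a Banach space $E$ let $J_E:E\to\ell_\infty(B_{E^*})$, $J_E(y)=(\langle y,y^*\rangle)_{y^*\in B_{E^*}}$, with $B_{E^*}$ the closed unit ball of $E^*$. The injective hull $\mathcal{I}^{inj}$ of a Lipschitz (resp. two-Lipschitz) operator ideal $\mathcal{I}$ consists of all $T\in Lip_0(X,E)$ (resp. $T\in BLip_0(X_1,X_2;E)$) such that $J_E\circ T$ belongs to $\mathcal{I}$; if $\mathcal{I}$ is normed, $\|T\|_{\mathcal{I}^{inj}}:=\|J_E\circ T\|_{\mathcal{I}}$. $\mathcal{I}$ is injective if $\mathcal{I}=\mathcal{I}^{inj}$ and, when $\mathcal{I}$ is normed, moreover $\|\cdot\|_{\mathcal{I}}=\|\cdot\|_{\mathcal{I}^{inj}}$. *)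

(* Defs.v *)
From HB Require Import structures.
From mathcomp Require Import all_boot all_order all_algebra.
From mathcomp Require Import complex.
From mathcomp Require Import boolp classical_sets functions reals topology normedtype.

Set Implicit Arguments.
Unset Strict Implicit.
Unset Printing Implicit Defensive.

Import Order.TTheory GRing.Theory Num.Theory.
Import numFieldNormedType.Exports.

Local Open Scope classical_set_scope.
Local Open Scope ring_scope.

(* Distances, norms and Lipschitz constants take their values in the scalar
   field itself, as in the structures [metricType K] and [normedModType K].
   For K = R[i], [0 <= z] says that z is a nonnegative real number, so these
   values are real in both cases and the order is total on them. *)

Variant scalars := RealScalars | ComplexScalars.

Definition scalarField (R : realType) (s : scalars) : numFieldType :=
  match s with RealScalars => R | ComplexScalars => R[i] end.

Section least_constants.
Variables (R : realType) (s : scalars).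
Local Notation K := (scalarField R s).

Lemma scalar_glb (A : set K) : A !=set0 -> (forall x, A x -> 0 <= x) ->
  exists c, [/\ 0 <= c, lbound A c &
    forall e, 0 < e -> exists2 a, A a & a <= c + e].
Proof.
case: s A => /= A [a0 Aa0] A0.
- have hA : has_inf A by split; [exists a0 | exists 0 => x /A0].
  exists (inf A); split.
  + by apply: lb_le_inf; [exists a0 | move=> x /A0].
  + by move=> x Ax; apply: ge_inf => //; case: hA.
  + move=> e e0; have [a Aa /ltW] := inf_adherent e0 hA; by exists a.
- pose B := [set r : R | A r%:C%C].
  have AB z : A z -> z = (complex.Re z)%:C%C.
    by move=> /A0; case: z => a b; rewrite lecE /= => /andP[/eqP -> _].
  have hB : has_inf B.
    split; first by exists (complex.Re a0); rewrite /B/= -AB.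
    by exists 0 => x /A0; rewrite lecE /= => /andP[].
  exists (inf B)%:C%C; split.
  + rewrite lecE /= eqxx /=; apply: lb_le_inf; first by case: hB.
    by move=> x /A0; rewrite lecE /= => /andP[].
  + move=> z Az; rewrite (AB z Az) lecE /= eqxx /=; apply: ge_inf; first by case: hB.
    by rewrite /B/= -AB.
  + move=> [e e'] /=; rewrite ltcE /= => /andP[/eqP -> e0].
    have [a Ba /ltW ae] := inf_adherent e0 hB.
    by exists a%:C%C => //; rewrite lecE /= addr0 eqxx.
Qed.

(* Every least constant below is the [infimum] of the set of admissible
   constants; this lemma shows that it is a minimum. *)
Lemma least_attained (A : set K) : A !=set0 -> (forall x, A x -> 0 <= x) ->
    (forall c, 0 <= c ->
       (forall e, 0 < e -> exists2 a, A a & a <= c + e) -> A c) ->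
  A (infimum 0 A) /\ lbound A (infimum 0 A).
Proof.
move=> AN0 A0 Acl; have [c [c0 cA cad]] := scalar_glb AN0 A0.
have infc : infimums A c by split=> // d; apply; exact: Acl.
suff -> : infimum 0 A = c by split=> //; exact: Acl.
rewrite /infimum; case: ifPn => [/eqP A00|_]; first by case: AN0; rewrite A00.
by apply: (@is_subset1_infimums _ _ A) => //; case: xgetP => // /(_ c).
Qed.

Lemma scalar_complete (F : set_system K^o) :
  ProperFilter F -> cauchy F -> cvg F.
Proof.
case: s F => /= F FF cF; first exact: (@R_complete R).
move/cauchyP in cF.
have ge_Re (z : R[i]) : `|complex.Re z|%:C%C <= `|z| by exact: normc_ge_Re.
have ge_Im (z : R[i]) : `|complex.Im z|%:C%C <= `|z|.
  by rewrite normc_def lecR -sqrtr_sqr ler_wsqrtr// lerDr sqr_ge0.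
have le_ReIm (z : R[i]) :
    `|z| <= (`|complex.Re z| + `|complex.Im z|)%:C%C.
  rewrite normc_def lecR -[leRHS]ger0_norm ?addr_ge0// -sqrtr_sqr.
  rewrite ler_wsqrtr// sqrrD !real_normK ?num_real// -addrA lerD2l.
  by rewrite lerDr mulrn_wge0// mulr_ge0.
have cvgp (p : R[i] -> R) : (forall z w, p (z - w) = p z - p w) ->
    (forall z, `|p z|%:C%C <= `|z|) -> cvg (p z @[z --> F]).
  move=> pB ple; apply: R_complete.
  apply: cauchy_exP => e e0.
  have [w Fw] := cF e%:C%C ltac:(by rewrite ltcR); exists (p w).
  apply: (@filterS _ F _ _ _ _ Fw) => z; rewrite /ball/= => wz.
  suff : `|p w - p z|%:C%C < e%:C%C by rewrite ltcR.
  by rewrite -pB (le_lt_trans (ple _)).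
have /cvg_ex[/= a Fa] : cvg (complex.Re z @[z --> F]).
  by apply: cvgp ge_Re => -[? ?] [? ?].
have /cvg_ex[/= b Fb] : cvg (complex.Im z @[z --> F]).
  by apply: cvgp ge_Im => -[? ?] [? ?].
apply/cvg_ex; exists (Complex a b); apply/cvgrPdist_lt => -[e e'] /=.
rewrite ltcE /= => /andP[/eqP -> e0].
have e20 : 0 < e / 2 by rewrite divr_gt0.
move: Fa Fb => /cvgrPdist_lt/(_ _ e20) Fa /cvgrPdist_lt/(_ _ e20) Fb.
apply: filterS2 Fa Fb => -[x y] /= ax byy.
by rewrite (le_lt_trans (le_ReIm _))// ltcR/= [ltRHS]splitr ltrD.
Qed.

End least_constants.

Definition scalar_banach (R : realType) (s : scalars) : Type :=
  (scalarField R s)^o.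

HB.instance Definition _ (R : realType) (s : scalars) :=
  NormedModule.copy (scalar_banach R s) (scalarField R s)^o.
HB.instance Definition _ (R : realType) (s : scalars) :=
  Uniform_isComplete.Build (scalar_banach R s) (@scalar_complete R s).

#[short(type="pointedMetricType")]
HB.structure Definition PointedMetric (K : numDomainType) :=
  {M of Metric K M & isPointed M}.

(* The [point] of a normed module need not be [0], hence this copy. *)
Definition at0 (K : numFieldType) (E : normedModType K) : Type := E.

Section at0.
Variables (K : numFieldType) (E : normedModType K).

Let dist (x y : at0 E) : K := `|(x : E) - (y : E)|.

Let distxx x : dist x x = 0.
Proof. by rewrite /dist subrr normr0. Qed.

Let dist_eq0 x y : dist x y = 0 -> x = y.
Proof. by move=> /normr0_eq0/eqP; rewrite subr_eq0 => /eqP. Qed.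

Let distC x y : dist x y = dist y x.
Proof. exact: distrC. Qed.

Let dist_triangle y x z : dist x z <= dist x y + dist y z.
Proof. exact: ler_distD. Qed.

HB.instance Definition _ := Choice.copy (at0 E) E.
HB.instance Definition _ :=
  isMetric.Build K (at0 E) distxx dist_eq0 distC dist_triangle.
HB.instance Definition _ := isPointed.Build (at0 E) (0 : E).

Lemma mdist_at0 (x y : at0 E) : mdist x y = `|(x : E) - (y : E)|.
Proof. by []. Qed.

End at0.

Section maps.
Variable K : numFieldType.

Definition lip_bounds (X Y : metricType K) (f : X -> Y) : set K :=
  [set C | 0 <= C /\ forall x y, mdist (f x) (f y) <= C * mdist x y].

Definition lip (X Y : metricType K) (f : X -> Y) : K :=
  infimum 0 (lip_bounds f).

Definition lip0 (X Y : pointedMetricType K) (f : X -> Y) : Prop :=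
  f point = point /\ lip_bounds f !=set0.

Definition op_bounds (E F : normedModType K) (w : E -> F) : set K :=
  [set C | 0 <= C /\ forall x, `|w x| <= C * `|x|].

Definition opnorm (E F : normedModType K) (w : E -> F) : K :=
  infimum 0 (op_bounds w).

Definition bounded_op (E F : normedModType K) (w : E -> F) : Prop :=
  linear w /\ op_bounds w !=set0.

Definition blip_bounds (X1 X2 : metricType K) (E : normedModType K)
    (T : X1 * X2 -> E) : set K :=
  [set C | 0 <= C /\ forall x1 x1' x2 x2',
    `|T (x1, x2) - T (x1, x2') - T (x1', x2) + T (x1', x2')|
      <= C * mdist x1 x1' * mdist x2 x2'].

Definition blip (X1 X2 : metricType K) (E : normedModType K)
    (T : X1 * X2 -> E) : K := infimum 0 (blip_bounds T).

Definition blip0 (X1 X2 : pointedMetricType K) (E : normedModType K)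
    (T : X1 * X2 -> E) : Prop :=
  [/\ forall x1, T (x1, point) = 0, forall x2, T (point, x2) = 0 &
      blip_bounds T !=set0].

Definition sup_bounds (I : Type) (E : normedModType K) (f : I -> E) : set K :=
  [set C | 0 <= C /\ forall i, `|f i| <= C].

Definition supnorm (I : Type) (E : normedModType K) (f : I -> E) : K :=
  infimum 0 (sup_bounds f).

End maps.

Section completeness.
Variables (K : numFieldType).

Lemma ler_mul_addgt0 (y C d : K) : 0 <= d ->
  (forall e, 0 < e -> y <= (C + e) * d) -> y <= C * d.
Proof.
rewrite le_eqVlt => /orP[/eqP <- /(_ 1 ltr01)|d0 H]; first by rewrite !mulr0.
apply/ler_addgt0Pr => e e0; have /H : 0 < e / d by rewrite divr_gt0.
by rewrite mulrDl divfK ?gt_eqF.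
Qed.

Lemma cvg_norm_le (T : Type) (G : set_system T) (E : normedModType K)
    (u : T -> E) (l : E) (C : K) : ProperFilter G ->
  u @ G --> l -> (\forall t \near G, `|u t| <= C) -> `|l| <= C.
Proof.
move=> GG /cvgrPdist_lt ul uC; apply/ler_addgt0Pr => e e0.
have [t [ut ltu]] := filter_ex (filterI uC (ul e e0)).
rewrite -(subrK (u t) l) addrC (le_trans (ler_normD _ _))// lerD//.
exact: ltW.
Qed.

Lemma pointwise_complete (V : normedModType K) (I : Type)
    (E : completeNormedModType K) (ev : V -> I -> E) :
    injective ev ->
    (forall f g i, ev (f - g) i = ev f i - ev g i) ->
    (forall i, exists2 k, 0 <= k & forall f, `|ev f i| <= k * `|f|) ->
    (forall (G : set_system V) (g : I -> E) f0 e, ProperFilter G ->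
       (forall i, ev f i @[f --> G] --> g i) ->
       (\forall f \near G, `|f0 - f| <= e) ->
       exists2 h, ev h = g & `|f0 - h| <= e) ->
  forall F : set_system V, ProperFilter F -> cauchy F -> cvg F.
Proof.
move=> evI evB evb evcl F FF /cauchyP cF.
have Fnear e : 0 < e -> exists f0, \forall f \near F, `|f0 - f| <= e.
  move=> /cF[f0 Ff0]; exists f0; apply: filterS Ff0 => f.
  by rewrite -ball_normE => /ltW.
have evcvg i : cvg (ev f i @[f --> F]).
  apply: cauchy_cvg; apply: cauchy_exP => e e0.
  have [k k0 kP] := evb i.
  have k10 : 0 < k + 1 by rewrite ltr_wpDl.
  have [f0 Ff0] := cF (e / (k + 1)) ltac:(by rewrite divr_gt0).
  exists (ev f0 i); apply: (@filterS _ F _ _ _ _ Ff0) => f.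
  rewrite -!ball_normE /= -evB ltr_pdivlMr// => fe.
  rewrite (le_lt_trans (kP _))// mulrC (le_lt_trans _ fe)// ler_wpM2l//.
  by rewrite lerDl.
pose g i := lim (ev f i @[f --> F]).
have Fg i : ev f i @[f --> F] --> g i by exact: evcvg.
have [f1 Ff1] := Fnear 1 ltr01.
have [h hg _] := evcl F g f1 1 FF Fg Ff1.
apply/cvg_ex; exists h; apply/cvgrPdist_lt => e e0.
have [f0 Ff0] := Fnear (e / 2 / 2) ltac:(by rewrite !divr_gt0).
have [h' h'g h'e] := evcl F g f0 _ FF Fg Ff0.
have {h'g}hh' : h' = h by apply: evI; rewrite h'g.
rewrite {}hh' in h'e; apply: filterS Ff0 => f fe.
rewrite (le_lt_trans (ler_distD f0 _ _))// [`|h - _|]distrC.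
rewrite (le_lt_trans (lerD h'e fe))// -splitr ltr_pdivrMr//.
by rewrite ltr_pMr// ltr1n.
Qed.

End completeness.

Section Lip0.
Variables (R : realType) (s : scalars).
Local Notation K := (scalarField R s).
Variables (X : pointedMetricType K) (E : completeNormedModType K).

Definition lip0_pred : {pred X -> E} := fun f => `[< lip0 (f : X -> at0 E) >].

Record Lip0 := MkLip0 { lip0_fun :> X -> E; _ : lip0_fun \in lip0_pred }.

HB.instance Definition _ := [isSub for lip0_fun].
HB.instance Definition _ := [Choice of Lip0 by <:].

Lemma lip0_submod_closed : submod_closed lip0_pred.
Proof.
split; first by apply/asboolP; split=> //; exists 0; split=> // x y;
  rewrite mdist_at0 subrr normr0 mul0r.
move=> a f g /asboolP[f0 [C [C0 fC]]] /asboolP[g0 [D [D0 gD]]].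
have {}f0 : f point = 0 := f0; have {}g0 : g point = 0 := g0.
have fgE x : (a *: f + g) x = a *: f x + g x by [].
apply/asboolP; split; first by rewrite fgE f0 g0 scaler0 addr0.
exists (`|a| * C + D); split; first by rewrite addr_ge0// mulr_ge0.
move=> x y; rewrite mdist_at0 !fgE opprD addrACA -scalerBr.
rewrite (le_trans (ler_normD _ _))// mulrDl lerD ?gD//.
by rewrite normrZ -mulrA ler_wpM2l ?fC.
Qed.

HB.instance Definition _ :=
  GRing.isSubmodClosed.Build K (X -> E) lip0_pred lip0_submod_closed.
HB.instance Definition _ := [SubChoice_isSubLmodule of Lip0 by <:].

Lemma lip0P (f : Lip0) : lip0 (f : X -> at0 E).
Proof. by apply/asboolP; exact: (valP f). Qed.

Lemma lip_least (f : X -> at0 E) : lip_bounds f !=set0 ->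
  lip_bounds f (lip f) /\ lbound (lip_bounds f) (lip f).
Proof.
move=> fN0; apply: least_attained => // [C []//|C C0 fC]; split=> // x y.
apply: ler_mul_addgt0 => [|e e0]; first exact: mdist_ge0.
have [D [_ fD] DC] := fC e e0.
by rewrite (le_trans (fD x y))// ler_wpM2r// mdist_ge0.
Qed.

Definition Lip0_norm (f : Lip0) : K := lip (f : X -> at0 E).

Lemma Lip0_norm_ge0 f : 0 <= Lip0_norm f.
Proof. by have [_ /lip_least[[]]] := lip0P f. Qed.

Lemma Lip0_normP (f : Lip0) x y : `|f x - f y| <= Lip0_norm f * mdist x y.
Proof. by have [_ /lip_least[[_ +] _]] := lip0P f; apply. Qed.

Lemma Lip0_norm_le (f : Lip0) C : 0 <= C ->
  (forall x y, `|f x - f y| <= C * mdist x y) -> Lip0_norm f <= C.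
Proof. by move=> C0 fC; have [_ /lip_least[_]] := lip0P f; apply. Qed.

Lemma Lip0_point (f : Lip0) : f point = 0.
Proof. by have [] := lip0P f. Qed.

Let Lip0_normD f g : Lip0_norm (f + g) <= Lip0_norm f + Lip0_norm g.
Proof.
apply: Lip0_norm_le => [|x y]; first by rewrite addr_ge0 ?Lip0_norm_ge0.
rewrite opprD addrACA (le_trans (ler_normD _ _))// mulrDl.
by rewrite lerD ?Lip0_normP.
Qed.

Let Lip0_normZ_le a f : Lip0_norm (a *: f) <= `|a| * Lip0_norm f.
Proof.
apply: Lip0_norm_le => [|x y]; first by rewrite mulr_ge0 ?Lip0_norm_ge0.
by rewrite -scalerBr normrZ -mulrA ler_wpM2l ?Lip0_normP.
Qed.

Let Lip0_normZ a f : Lip0_norm (a *: f) = `|a| * Lip0_norm f.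
Proof.
apply/eqP; rewrite eq_le Lip0_normZ_le /=.
have [->|a0] := eqVneq a 0; first by rewrite normr0 mul0r Lip0_norm_ge0.
rewrite -[f in leLHS](scalerK a0) -ler_pdivlMl ?normr_gt0//.
by rewrite (le_trans (Lip0_normZ_le _ _))// normfV.
Qed.

Let Lip0_norm_eq0 f : Lip0_norm f = 0 -> f = 0.
Proof.
move=> f0; apply: val_inj; apply/funext => x.
have := Lip0_normP f x point.
by rewrite f0 mul0r Lip0_point subr0 normr_le0 => /eqP.
Qed.

HB.instance Definition _ := Lmodule_isNormed.Build K Lip0
  Lip0_normD Lip0_normZ Lip0_norm_eq0.

Let Lip0_complete (F : set_system Lip0) : ProperFilter F -> cauchy F -> cvg F.
Proof.
apply: (@pointwise_complete K Lip0 X E lip0_fun) => //.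
- exact: val_inj.
- move=> x; exists (mdist x point); first exact: mdist_ge0.
  by move=> f; have := Lip0_normP f x point; rewrite Lip0_point subr0 mulrC.
move=> G g f0 e GG Gg Ge.
have [f1 f1e] := filter_ex Ge; have e0 : 0 <= e by exact: le_trans f1e.
have fgP x y : `|(f0 x - g x) - (f0 y - g y)| <= e * mdist x y.
  apply: (@cvg_norm_le _ _ G _ (fun f : Lip0 => (f0 x - f x) - (f0 y - f y))).
    by apply: cvgB; apply: cvgB => //; exact: cvg_cst.
  apply: filterS Ge => f fe; rewrite (le_trans (Lip0_normP (f0 - f) _ _))//.
  by rewrite ler_wpM2r ?mdist_ge0.
have g0 : g point = 0.
  apply/eqP; rewrite -normr_le0.
  apply: (@cvg_norm_le _ _ G _ (fun f : Lip0 => f point)) => //.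
  by apply: nearW => f; rewrite Lip0_point normr0.
have up : ((f0 : X -> E) - g) \in lip0_pred.
  apply/asboolP; split; last by exists e; split.
  by rewrite -[LHS]/(f0 point - g point) Lip0_point g0 subr0.
exists (f0 - MkLip0 up).
  by apply/funext => x; rewrite -[LHS]/(f0 x - (f0 x - g x)) subKr.
by rewrite subKr Lip0_norm_le.
Qed.

HB.instance Definition _ := Uniform_isComplete.Build Lip0 Lip0_complete.

Lemma Lip0_normE (f : Lip0) : `|f| = lip (f : X -> at0 E).
Proof. by []. Qed.

End Lip0.

Section ell_infty.
Variables (R : realType) (s : scalars).
Local Notation K := (scalarField R s).
Variable I : Type.
Local Notation B := (scalar_banach R s).

Definition ell_infty_pred : {pred I -> B} :=
  fun f => `[< sup_bounds f !=set0 >].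

Record ell_infty :=
  MkEllInfty { ell_infty_fun :> I -> B; _ : ell_infty_fun \in ell_infty_pred }.

HB.instance Definition _ := [isSub for ell_infty_fun].
HB.instance Definition _ := [Choice of ell_infty by <:].

Lemma ell_infty_submod_closed : submod_closed ell_infty_pred.
Proof.
split; first by apply/asboolP; exists 0; split=> // i; rewrite normr0.
move=> a f g /asboolP[C [C0 fC]] /asboolP[D [D0 gD]]; apply/asboolP.
exists (`|a| * C + D); split=> [|i]; first by rewrite addr_ge0// mulr_ge0.
rewrite -[(a *: f + g) i]/(a *: f i + g i) (le_trans (ler_normD _ _))//.
by rewrite lerD ?gD// normrZ ler_wpM2l.
Qed.

HB.instance Definition _ :=
  GRing.isSubmodClosed.Build K (I -> B) ell_infty_pred ell_infty_submod_closed.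
HB.instance Definition _ := [SubChoice_isSubLmodule of ell_infty by <:].

Let norm (f : ell_infty) : K := supnorm f.

Lemma supnorm_least (f : I -> B) : sup_bounds f !=set0 ->
  sup_bounds f (supnorm f) /\ lbound (sup_bounds f) (supnorm f).
Proof.
move=> fN0; apply: least_attained => // [C []//|C C0 fC]; split=> // i.
apply/ler_addgt0Pr => e e0; have [D [_ fD]] := fC e e0.
exact: le_trans.
Qed.

Let normP (f : ell_infty) : sup_bounds f (norm f).
Proof. by have /asboolP/supnorm_least[] := valP f. Qed.

Let norm_ge0 f : 0 <= norm f. Proof. by case: (normP f). Qed.

Let norm_ub (f : ell_infty) i : `|f i| <= norm f.
Proof. by case: (normP f). Qed.

Let norm_le (f : ell_infty) C :
  0 <= C -> (forall i, `|f i| <= C) -> norm f <= C.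
Proof. by move=> C0 fC; have /asboolP/supnorm_least[_] := valP f; apply. Qed.

Let normD f g : norm (f + g) <= norm f + norm g.
Proof.
apply: norm_le => [|i]; first by rewrite addr_ge0 ?norm_ge0.
by rewrite (le_trans (ler_normD _ _))// lerD.
Qed.

Let normZ_le a f : norm (a *: f) <= `|a| * norm f.
Proof.
apply: norm_le => [|i]; first by rewrite mulr_ge0 ?norm_ge0.
by rewrite normrZ ler_wpM2l.
Qed.

Let normZ a f : norm (a *: f) = `|a| * norm f.
Proof.
apply/eqP; rewrite eq_le normZ_le /=.
have [->|a0] := eqVneq a 0; first by rewrite normr0 mul0r norm_ge0.
rewrite -[f in leLHS](scalerK a0) -ler_pdivlMl ?normr_gt0//.
by rewrite (le_trans (normZ_le _ _))// normfV.
Qed.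

Let norm_eq0 f : norm f = 0 -> f = 0.
Proof.
move=> f0; apply: val_inj; apply/funext => i.
by have := norm_ub f i; rewrite f0 normr_le0 => /eqP.
Qed.

HB.instance Definition _ := Lmodule_isNormed.Build K ell_infty
  normD normZ norm_eq0.

Let ell_infty_complete (F : set_system ell_infty) :
  ProperFilter F -> cauchy F -> cvg F.
Proof.
apply: (@pointwise_complete K ell_infty I B ell_infty_fun) => //.
- exact: val_inj.
- by move=> i; exists 1 => // f; rewrite mul1r; exact: norm_ub.
move=> G g f0 e GG Gg Ge.
have [f1 f1e] := filter_ex Ge; have e0 : 0 <= e by exact: le_trans f1e.
have fgP i : `|f0 i - g i| <= e.
  apply: (@cvg_norm_le _ _ G _ (fun f : ell_infty => f0 i - f i)).
    by apply: cvgB => //; exact: cvg_cst.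
  by apply: filterS Ge => f; apply: le_trans; exact: (norm_ub (f0 - f)).
have up : ((f0 : I -> B) - g) \in ell_infty_pred.
  by apply/asboolP; exists e.
exists (f0 - MkEllInfty up).
  by apply/funext => i; rewrite -[LHS]/(f0 i - (f0 i - g i)) subKr.
by rewrite subKr; exact: norm_le.
Qed.

HB.instance Definition _ :=
  Uniform_isComplete.Build ell_infty ell_infty_complete.

Lemma ell_infty_normE (f : ell_infty) : `|f| = supnorm f.
Proof. by []. Qed.

End ell_infty.

Section embedding.
Variables (R : realType) (s : scalars).
Local Notation K := (scalarField R s).
Local Notation B := (scalar_banach R s).
Local Notation Metr := (pointedMetricType K).
Local Notation Ban := (completeNormedModType K).
Variable E : Ban.

Record dual_ball := DualBall {
  dual_ball_fun :> E -> B;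
  dual_ball_op : bounded_op dual_ball_fun;
  dual_ball_le1 : opnorm dual_ball_fun <= 1 }.

Lemma opnorm_least (F : normedModType K) (w : E -> F) : op_bounds w !=set0 ->
  op_bounds w (opnorm w) /\ lbound (op_bounds w) (opnorm w).
Proof.
move=> wN0; apply: least_attained => // [C []//|C C0 wC]; split=> // x.
apply: ler_mul_addgt0 => [//|e e0].
have [D [_ wD] DC] := wC e e0.
by rewrite (le_trans (wD x))// ler_wpM2r.
Qed.

Lemma embed_subproof (y : E) :
  (fun phi : dual_ball => phi y) \in @ell_infty_pred R s dual_ball.
Proof.
apply/asboolP; exists `|y|; split=> // phi.
have [_ /opnorm_least[[_ le_phi] _]] := dual_ball_op phi.
by rewrite (le_trans (le_phi y))// ler_piMl// dual_ball_le1.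
Qed.

(* J_E *)
Definition embed (y : E) : ell_infty R s dual_ball :=
  MkEllInfty (embed_subproof y).

End embedding.

Section lipschitz_ideals.
Variables (R : realType) (s : scalars).
Local Notation K := (scalarField R s).
Local Notation B := (scalar_banach R s).
Local Notation Metr := (pointedMetricType K).
Local Notation Ban := (completeNormedModType K).

(* A class is given by its components; [lip_ideal_lip0] makes them subsets of
   Lip_0(X, E). *)
Definition lip_class : Type :=
  forall (X : Metr) (E : Ban), set (X -> E).

(* Values of a [lip_norm] outside the class it is paired with are irrelevant. *)
Definition lip_norm : Type :=
  forall (X : Metr) (E : Ban), (X -> E) -> K.

Record lip_ideal (I : lip_class) : Prop := {
  lip_ideal_lip0 : forall (X : Metr) (E : Ban) (T : X -> E),
    I X E T -> lip0 (T : X -> at0 E);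
  lip_ideal_zero : forall X E, I X E (fun=> 0 : E);
  lip_ideal_linear : forall (X : Metr) (E : Ban) (a : K) (T U : X -> E),
    I X E T -> I X E U -> I X E (fun x => a *: T x + U x);
  lip_ideal_rank1 : forall (X : Metr) (E : Ban) (v : E) (g : X -> B),
    lip0 (g : X -> at0 B) -> I X E (fun x => (g x : K) *: v);
  lip_ideal_comp : forall (Y X : Metr) (E F : Ban)
      (S : Y -> X) (T : X -> E) (w : E -> F),
    lip0 S -> I X E T -> bounded_op w -> I Y F (w \o T \o S) }.

Record normed_lip_ideal (I : lip_class) (N : lip_norm) : Prop := {
  normed_lip_ideal_ideal : lip_ideal I;
  normed_lip_ideal_ge0 : forall X E T, I X E T -> 0 <= N X E T;
  normed_lip_ideal_eq0 : forall X E T,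
    I X E T -> N X E T = 0 -> T = (fun=> 0 : E);
  normed_lip_idealZ : forall X E (a : K) T,
    I X E T -> N X E (fun x => a *: T x) = `|a| * N X E T;
  normed_lip_idealD : forall X E T U, I X E T -> I X E U ->
    N X E (fun x => T x + U x) <= N X E T + N X E U;
  normed_lip_ideal_lip : forall X E T,
    I X E T -> lip (T : X -> at0 E) <= N X E T;
  normed_lip_ideal_id : N (at0 B) B (id : at0 B -> B) = 1;
  normed_lip_ideal_comp : forall (Y X : Metr) (E F : Ban)
      (S : Y -> X) (T : X -> E) (w : E -> F),
    lip0 S -> I X E T -> bounded_op w ->
    N Y F (w \o T \o S) <= lip S * N X E T * opnorm w }.

Definition lip_inj_hull (I : lip_class) : lip_class := fun X E =>
  [set T | lip0 (T : X -> at0 E) /\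
           I X (ell_infty R s (dual_ball E)) (@embed R s E \o T)].

Definition lip_inj_norm (N : lip_norm) : lip_norm := fun X E T =>
  N X (ell_infty R s (dual_ball E)) (@embed R s E \o T).

Definition lip_injective (I : lip_class) : Prop :=
  I = lip_inj_hull I.

Definition normed_lip_injective (I : lip_class) (N : lip_norm) : Prop :=
  lip_injective I /\ forall X E T, I X E T -> N X E T = lip_inj_norm N T.

End lipschitz_ideals.

Section two_lipschitz_ideals.
Variables (R : realType) (s : scalars).
Local Notation K := (scalarField R s).
Local Notation B := (scalar_banach R s).
Local Notation Metr := (pointedMetricType K).
Local Notation Ban := (completeNormedModType K).

Definition blip_class : Type :=
  forall (X1 X2 : Metr) (E : Ban),
    set (X1 * X2 -> E).

Definition blip_norm : Type :=
  forall (X1 X2 : Metr) (E : Ban),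
    (X1 * X2 -> E) -> K.

Record blip_ideal (J : blip_class) : Prop := {
  blip_ideal_blip0 : forall X1 X2 E T, J X1 X2 E T -> blip0 T;
  blip_ideal_zero : forall X1 X2 E, J X1 X2 E (fun=> 0 : E);
  blip_ideal_linear : forall X1 X2 E (a : K) T U,
    J X1 X2 E T -> J X1 X2 E U -> J X1 X2 E (fun x => a *: T x + U x);
  blip_ideal_rank1 : forall (X1 X2 : Metr) (E : Ban) (e : E)
      (f1 : X1 -> B) (f2 : X2 -> B),
    lip0 (f1 : X1 -> at0 B) -> lip0 (f2 : X2 -> at0 B) ->
    J X1 X2 E (fun x => ((f1 x.1 : K) * (f2 x.2 : K)) *: e);
  blip_ideal_comp : forall (Z W X1 X2 : Metr) (E F : Ban)
      (f1 : Z -> X1) (f2 : W -> X2) (T : X1 * X2 -> E) (u : E -> F),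
    lip0 f1 -> lip0 f2 -> J X1 X2 E T -> bounded_op u ->
    J Z W F (fun z => u (T (f1 z.1, f2 z.2))) }.

(* The norm axioms are those of [normed_lip_ideal] with the scalar
   multiplication K * K -> K in place of the identity of K. *)
Record normed_blip_ideal (J : blip_class) (N : blip_norm) : Prop := {
  normed_blip_ideal_ideal : blip_ideal J;
  normed_blip_ideal_ge0 : forall X1 X2 E T, J X1 X2 E T -> 0 <= N X1 X2 E T;
  normed_blip_ideal_eq0 : forall X1 X2 E T,
    J X1 X2 E T -> N X1 X2 E T = 0 -> T = (fun=> 0 : E);
  normed_blip_idealZ : forall X1 X2 E (a : K) T, J X1 X2 E T ->
    N X1 X2 E (fun x => a *: T x) = `|a| * N X1 X2 E T;
  normed_blip_idealD : forall X1 X2 E T U, J X1 X2 E T -> J X1 X2 E U ->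
    N X1 X2 E (fun x => T x + U x) <= N X1 X2 E T + N X1 X2 E U;
  normed_blip_ideal_blip : forall X1 X2 E T,
    J X1 X2 E T -> blip T <= N X1 X2 E T;
  normed_blip_ideal_mul :
    N (at0 B) (at0 B) B (fun x => (x.1 : K) * (x.2 : K)) = 1;
  normed_blip_ideal_comp : forall (Z W X1 X2 : Metr) (E F : Ban)
      (f1 : Z -> X1) (f2 : W -> X2) (T : X1 * X2 -> E) (u : E -> F),
    lip0 f1 -> lip0 f2 -> J X1 X2 E T -> bounded_op u ->
    N Z W F (fun z => u (T (f1 z.1, f2 z.2)))
      <= opnorm u * N X1 X2 E T * lip f1 * lip f2 }.

Definition blip_inj_hull (J : blip_class) : blip_class := fun X1 X2 E =>
  [set T | blip0 T /\
           J X1 X2 (ell_infty R s (dual_ball E)) (@embed R s E \o T)].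

Definition blip_inj_norm (N : blip_norm) : blip_norm := fun X1 X2 E T =>
  N X1 X2 (ell_infty R s (dual_ball E)) (@embed R s E \o T).

Definition blip_injective (J : blip_class) : Prop :=
  J = blip_inj_hull J.

Definition normed_blip_injective (J : blip_class) (N : blip_norm) : Prop :=
  blip_injective J /\
  forall X1 X2 E T, J X1 X2 E T -> N X1 X2 E T = blip_inj_norm N T.

Section bracket.
Variables (X1 X2 : Metr) (E : Ban).

(* The default value [0] of [insubd] is never used when [blip0 T] holds, see
   [assoc1E] and [assoc2E]. *)
Definition assoc1 (T : X1 * X2 -> E) (x1 : X1) : Lip0 X2 E :=
  insubd (0 : Lip0 X2 E) (fun x2 => T (x1, x2)).

Definition assoc2 (T : X1 * X2 -> E) (x2 : X2) : Lip0 X1 E :=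
  insubd (0 : Lip0 X1 E) (fun x1 => T (x1, x2)).

Lemma assoc1E T x1 x2 : blip0 T -> assoc1 T x1 x2 = T (x1, x2).
Proof.
move=> [T0 T0' [C [C0 TC]]]; suff TL :
    (fun x2 => T (x1, x2)) \in @lip0_pred R s X2 E.
  by rewrite /assoc1 (insubdK 0 TL).
apply/asboolP; split; first exact: T0.
exists (C * mdist x1 point); split; first by rewrite mulr_ge0 ?mdist_ge0.
move=> x y; rewrite mdist_at0; have := TC x1 point x y.
by rewrite !T0' subr0 addr0.
Qed.

Lemma assoc2E T x1 x2 : blip0 T -> assoc2 T x2 x1 = T (x1, x2).
Proof.
move=> [T0 T0' [C [C0 TC]]]; suff TL :
    (fun x1 => T (x1, x2)) \in @lip0_pred R s X1 E.
  by rewrite /assoc2 (insubdK 0 TL).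
apply/asboolP; split; first exact: T0'.
exists (C * mdist x2 point); split; first by rewrite mulr_ge0 ?mdist_ge0.
move=> x y; rewrite mdist_at0; have := TC x y x2 point.
by rewrite !T0 subr0 addr0 mulrAC.
Qed.

End bracket.

Definition bracket (I1 I2 : lip_class R s) : blip_class := fun X1 X2 E =>
  [set T | [/\ blip0 T, I1 X1 (Lip0 X2 E) (assoc1 T) &
               I2 X2 (Lip0 X1 E) (assoc2 T)]].

Definition bracket_norm (N1 N2 : lip_norm R s) : blip_norm := fun X1 X2 E T =>
  Num.max (N1 X1 (Lip0 X2 E) (assoc1 T)) (N2 X2 (Lip0 X1 E) (assoc2 T)).

End two_lipschitz_ideals.

(* Main.v *)
Require Import Defs.
From HB Require Import structures.
From mathcomp Require Import all_boot all_order all_algebra.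
From mathcomp Require Import complex ring lra.
From mathcomp Require Import boolp classical_sets functions reals topology normedtype.

(** For [T] in BLip_0(X1, X2; E) the associated map of [J_E \o T] is the
    associated map of [T] followed by the operator
    [U : Lip0(X2, E) -> Lip0(X2, l_infty(B_E* ))], [U g = J_E \o g], which is
    isometric because [J_E] is. So the question is whether an injective ideal
    cannot distinguish a map [A : X1 -> G] from its composite [U \o A] with an
    isometry [U : G -> H], although injectivity only speaks of the particular
    isometry [J_G] with [G = Lip0(X2, E)].

    It cannot, since [J_G] factors through [U] by an operator of norm at most 1:
    by Hahn-Banach every functional in the unit ball of [G*], seen on [U(G)],
    extends to [H] with norm at most 1, and the chosen extensions are the
    coordinates of an operator [w : H -> l_infty(B_G* )] with [w \o U = J_G]
    ([embed_factorization]). Thus [U \o A] in the ideal gives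
    [J_G \o A = w \o U \o A] in the ideal, hence [A] in the ideal, and the norms
    of [A] and [U \o A] agree ([lip_injective_isometry],
    [normed_lip_injective_isometry]). Hahn-Banach is proved for real scalars by
    applying Zorn's lemma to graphs of dominated linear functionals, and
    transferred to complex scalars by taking real parts.

    The rest is formal. The bracket is the intersection of the class of those
    [T] with [T_1] in the first ideal and of the class of those [T] with [T_2]
    in the second. As [T_2] is the first associated map of [T] with its two
    variables exchanged, it suffices to treat [T_1] and to observe that
    exchanging the variables and intersecting preserve ideals, norms and
    injectivity. *)

Set Implicit Arguments.
Unset Strict Implicit.
Unset Printing Implicit Defensive.

Import Order.TTheory GRing.Theory Num.Theory.
Import numFieldNormedType.Exports.

Local Open Scope classical_set_scope.
Local Open Scope ring_scope.

(** * The Hahn-Banach theorem for real and complex scalars *)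

Section hahn_banach.
Variables (R : realType) (V : lmodType R) (p : V -> R).
Hypothesis pD : forall x y, p (x + y) <= p x + p y.
Hypothesis pZ : forall a x, 0 <= a -> p (a *: x) = a * p x.

(** Partial linear functionals are represented by their graphs, so that
    extension is inclusion. For a set closed under linear combinations, being
    dominated by [p] already forces it to be the graph
    of a function, see [dominated_graph_functional]. *)
Definition dominated_graph (G : set (V * R^o)) : Prop :=
  [/\ G 0, forall a u w, G u -> G w -> G (a *: u + w) &
      forall u, G u -> u.2 <= p u.1].

(** The difference of two values at [v] is a value at [0], hence at most
    [p 0 = 0], and so is its opposite. *)
Lemma dominated_graph_functional G v a b :
  dominated_graph G -> G (v, a) -> G (v, b) -> a = b.
Proof.
move=> [_ Glin Gp].
have p0 : p 0 = 0 by have := @pZ 0 0 (lexx 0); rewrite scaler0 mul0r.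
have le c d : G (v, c) -> G (v, d) -> d <= c.
  move=> Gc Gd; have := Gp _ (Glin (-1) _ _ Gc Gd).
  by rewrite /= !scaleN1r addNr p0 addrC subr_le0.
by move=> Ga Gb; apply/eqP; rewrite eq_le !le.
Qed.

(** The value [c] given to [v] has to satisfy
    [a - p (x - v) <= c <= p (y + v) - b] for all [(x, a)] and [(y, b)] in [G].
    Such a [c] exists since
    [a + b <= p (x + y) <= p (x - v) + p (y + v)]. *)
Lemma dominated_graph_extend G v : dominated_graph G ->
  exists G', [/\ dominated_graph G', G `<=` G' & exists c, G' (v, c)].
Proof.
move=> [G0 Glin Gp].
pose S := [set r | exists2 u, G u & r = u.2 - p (u.1 - v)].
have Sub u : G u -> ubound S (p (u.1 + v) - u.2).
  move=> Gu _ [w Gw ->]; have Gwu := Glin 1 _ _ Gw Gu.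
  have := Gp _ Gwu; rewrite /= !scale1r => le1.
  have := pD (w.1 - v) (u.1 + v); rewrite addrACA addNr addr0.
  by move: le1 => /=; lra.
have hS : has_sup S.
  split; first by exists (0 - p (0 - v)), 0.
  by exists (p (0 + v) - 0); exact: (Sub 0).
pose c := sup S.
have leSc u : G u -> u.2 - p (u.1 - v) <= c.
  by move=> Gu; apply: ub_le_sup; [case: hS | exists u].
have lecS u : G u -> c <= p (u.1 + v) - u.2.
  by move=> Gu; apply: ge_sup; [case: hS | exact: Sub].
have Gscale a u : G u -> G (a *: u).
  by move=> Gu; rewrite -[_ *: _]addr0; exact: Glin.
exists [set u | exists t, exists2 g, G g & u = t *: (v, c : R^o) + g]; split.
- split.
  + by exists 0, 0 => //; rewrite scale0r addr0.
  + move=> a _ _ [t [g Gg ->]] [t' [g' Gg' ->]].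
    exists (a * t + t'), (a *: g + g'); first exact: Glin.
    by rewrite scalerDr scalerA addrACA scalerDl.
  + move=> _ [t [g Gg ->]] /=.
    case: (ltgtP t 0) => [t0|t0|->].
    (* For [t] of either sign, the bound is that on [c] at [g] divided by the
       absolute value of [t]. *)
    * have t'0 : 0 < - t by rewrite oppr_gt0.
      have -> : t *: v + g.1 = (- t) *: ((- t)^-1 *: g.1 - v).
        rewrite scalerBr scalerA divff ?gt_eqF// scale1r addrC.
        by rewrite scaleNr opprK.
      rewrite (pZ _ (ltW t'0)) -[t *: _]/(t * _).
      have := leSc _ (Gscale (- t)^-1 _ Gg).
      rewrite -(ler_pM2l t'0) mulrBr /=.
      rewrite -[(- t)^-1 *: g.2]/((- t)^-1 * g.2) mulVKf ?gt_eqF//.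
      lra.
    * have -> : t *: v + g.1 = t *: (t^-1 *: g.1 + v).
        by rewrite scalerDr scalerA divff ?gt_eqF// scale1r addrC.
      rewrite (pZ _ (ltW t0)) -[t *: _]/(t * _).
      have := lecS _ (Gscale t^-1 _ Gg).
      rewrite -(ler_pM2l t0) mulrBr /=.
      rewrite -[t^-1 *: g.2]/(t^-1 * g.2) mulVKf ?gt_eqF//.
      by rewrite lerBrDr.
    * by rewrite !scale0r !add0r; exact: Gp.
- by move=> u Gu; exists 0, u => //; rewrite scale0r add0r.
- by exists c, 1, 0 => //; rewrite scale1r addr0.
Qed.

(** Zorn's lemma gives a maximal dominated graph containing [G0]; its domain is
    everything because any further vector could be added to it. *)
Lemma hahn_banach_graph G0 : dominated_graph G0 ->
  exists2 g : V -> R, scalar g &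
    (forall v, g v <= p v) /\ forall u, G0 u -> g u.1 = u.2.
Proof.
move=> dG0.
(* Uniting with [G0] in [P] makes the empty chain harmless: its union is the
   empty set, which is not a dominated graph. *)
pose P H := dominated_graph (G0 `|` H).
have [|M [PM maxM]] := @Zorn_bigcup _ P.
  move=> F FP Ftot.
  have cover u w : (G0 `|` \bigcup_(H in F) H) u ->
      (G0 `|` \bigcup_(H in F) H) w ->
      exists H, [/\ P H, (G0 `|` H) u, (G0 `|` H) w &
        G0 `|` H `<=` G0 `|` \bigcup_(H in F) H].
    have P0 : P set0 by rewrite /P setU0.
    have sub H : F H -> G0 `|` H `<=` G0 `|` \bigcup_(H in F) H.
      by move=> FH; apply: setUS; exact: bigcup_sup.
    move=> [Gu|[H FH Hu]] [Gw|[H' FH' Hw]].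
    + by exists set0; split=> //; [left|left|rewrite setU0; exact: subsetUl].
    + by exists H'; split; [exact: FP|left|right|exact: sub].
    + by exists H; split; [exact: FP|right|left|exact: sub].
    + have [HH'|H'H] := Ftot _ _ FH FH'.
      * by exists H'; split; [exact: FP|right; exact: HH'|right|exact: sub].
      * by exists H; split; [exact: FP|right|right; exact: H'H|exact: sub].
  split; first by left; case: dG0.
  - move=> a u w Gu Gw; have [H [[_ Hlin _] Hu Hw]] := cover _ _ Gu Gw.
    by apply; exact: Hlin.
  - by move=> u Gu; have [H [[_ _ Hp] Hu _ _]] := cover _ _ Gu Gu; exact: Hp.
have total v : exists r : R^o, (G0 `|` M) (v, r).
  have [G' [dG' MG' [c G'c]]] := dominated_graph_extend v PM.
  exists c; apply: contrapT => nMc; apply: (maxM G').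
    split; first by move=> u Mu; apply: MG'; right.
    by move=> /(_ _ G'c) Mc; apply: nMc; right.
  by rewrite /P setUidr// => u G0u; apply: MG'; left.
have [g gM] := choice total; exists g.
  move=> a u w; apply: (dominated_graph_functional PM (gM _)).
  by have [_ Mlin _] := PM; exact: (Mlin a _ _ (gM u) (gM w)).
split=> [v|[v r] G0v]; first by have [_ _ Mp] := PM; exact: (Mp _ (gM v)).
by apply: (dominated_graph_functional PM (gM v)); left.
Qed.

End hahn_banach.

Section linear_maps.
Variables (K : pzRingType) (U W : lmodType K) (f : U -> W).
Hypothesis flin : linear f.

Lemma linear_map0 : f 0 = 0.
Proof. by have := flin (-1) 0 0; rewrite scaler0 addr0 scaleN1r addNr. Qed.

Lemma linear_mapZ a u : f (a *: u) = a *: f u.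
Proof. by have := flin a u 0; rewrite linear_map0 !addr0. Qed.

Lemma linear_mapD u v : f (u + v) = f u + f v.
Proof. by have := flin 1 u v; rewrite !scale1r. Qed.

Lemma linear_mapB u v : f (u - v) = f u - f v.
Proof. by rewrite -[- v]scaleN1r linear_mapD linear_mapZ scaleN1r. Qed.

End linear_maps.

Lemma real_functional_extension (R : realType) (E V : normedModType R)
    (j : E -> V) (phi : E -> R) : linear j -> scalar phi ->
  (forall x, `|phi x| <= `|j x|) ->
  exists psi : V -> R, [/\ scalar psi,
    forall v, `|psi v| <= `|v| & forall x, psi (j x) = phi x].
Proof.
move=> jlin philin phij.
pose G := [set u : V * R^o | exists x, u = (j x, phi x)].
have dG : dominated_graph (fun v : V => `|v|) G.
  split.
  - exists 0; rewrite (linear_map0 jlin).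
    by rewrite (linear_map0 (philin : linear (phi : E -> R^o))).
  - by move=> a _ _ [x ->] [y ->]; exists (a *: x + y); rewrite jlin philin.
  - by move=> _ [x ->]; exact: le_trans (ler_norm _) (phij x).
have [||psi psilin [psi_le psiG]] := hahn_banach_graph _ _ dG.
- exact: ler_normD.
- by move=> a x a0; rewrite normrZ ger0_norm.
exists psi; split=> // [v|x]; last by rewrite (psiG (j x, phi x)) //; exists x.
rewrite ler_norml psi_le andbT lerNl.
have <- : psi (- v) = - psi v.
  rewrite -scaleN1r (linear_mapZ (psilin : linear (psi : V -> R^o))).
  by rewrite scaleN1r.
by rewrite (le_trans (psi_le _)) ?normrN.
Qed.

(** A complex normed space is to be seen as a real vector space, but its carrier
    already has a complex module structure: hence a copy. *)
Section realification.
Variables (R : rcfType) (V : lmodType R[i]).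
Local Open Scope complex_scope.

Definition realification : Type := V.

HB.instance Definition _ := GRing.Zmodule.on realification.

Let rscale (r : R) (v : realification) : realification := r%:C *: (v : V).

Let rscaleA a b v : rscale a (rscale b v) = rscale (a * b) v.
Proof. by rewrite /rscale scalerA -rmorphM. Qed.

Let rscale1 : left_id 1 rscale.
Proof. by move=> v; rewrite /rscale scale1r. Qed.

Let rscaleDr : right_distributive rscale +%R.
Proof. by move=> a u v; rewrite /rscale scalerDr. Qed.

Let rscaleDl v : {morph rscale^~ v : a b / a + b}.
Proof. by move=> a b; rewrite /rscale rmorphD scalerDl. Qed.

HB.instance Definition _ := GRing.Zmodule_isLmodule.Build R realification
  rscaleA rscale1 rscaleDr rscaleDl.

Lemma realificationZ (r : R) (v : realification) : r *: v = r%:C *: (v : V).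
Proof. by []. Qed.

End realification.

Section complex_functional_extension.
Variable R : realType.
Local Open Scope complex_scope.

(** A complex functional is determined by its real part:
    [psi v = Re (psi v) - i Re (psi (i v))]. So the real part of [phi] is
    extended, and this formula turns the extension [g] into [psi]. The bound for
    [psi] follows from the one for [g] at the multiple [u v], [|u| = 1], for
    which [psi (u v) = |psi v|] is real. *)
Lemma complex_functional_extension (E V : normedModType R[i])
    (j : E -> V) (phi : E -> R[i]) : linear j -> scalar phi ->
  (forall x, `|phi x| <= `|j x|) ->
  exists psi : V -> R[i], [/\ scalar psi,
    forall v, `|psi v| <= `|v| & forall x, psi (j x) = phi x].
Proof.
move=> jlin philin phij.
have philin' : linear (phi : E -> R[i]^o) := philin.
have ReM (a b : R[i]) : complex.Re (a * b) =
    complex.Re a * complex.Re b - complex.Im a * complex.Im b.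
  by case: a b => [? ?] [].
have ReD (a b : R[i]) : complex.Re (a + b) = complex.Re a + complex.Re b.
  by case: a b => [? ?] [].
have Re_le (a b : R[i]) : a <= b -> complex.Re a <= complex.Re b.
  by rewrite lecE => /andP[].
have normE (v : V) : `|v| = (complex.Re `|v|)%:C.
  by rewrite RRe_real// ger0_real.
pose W := realification V.
pose p (v : W) := complex.Re `|(v : V)|.
pose G := [set u : W * R^o | exists x, u = (j x, complex.Re (phi x))].
have dG : dominated_graph p G.
  split.
  - by exists 0; rewrite (linear_map0 jlin) (linear_map0 philin').
  - move=> a _ _ [x ->] [y ->]; exists (a%:C *: x + y).
    rewrite jlin philin ReD ReM /= mul0r subr0; congr pair.
  - move=> _ [x ->]; apply: le_trans (Re_le _ _ (phij x)) => /=.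
    have := normc_ge_Re (phi x); rewrite lecE /= => /andP[_].
    by apply: le_trans; exact: ler_norm.
have [||g glin [g_le gG]] := hahn_banach_graph _ _ dG.
- by move=> x y; rewrite /p -ReD Re_le// ler_normD.
- move=> a x a0.
  by rewrite /p realificationZ normrZ ger0_norm ?ler0c// ReM /= mul0r subr0.
have glin' : linear (g : W -> R^o) := glin.
have gD (u v : V) : g (u + v : V) = g u + g v := linear_mapD glin' u v.
have gZ (a : R) (u : V) : g (a%:C *: u) = a * g u := linear_mapZ glin' a u.
pose psi (v : V) : R[i] := Complex (g v) (- g ('i *: v)).
have psilin : scalar psi.
  move=> a u v; rewrite /psi scalerDr !gD.
  have gC (c : R[i]) (w : V) :
      g (c *: w) = complex.Re c * g w + complex.Im c * g ('i *: w).
    by rewrite {1}[c]complexE scalerDl gD gZ ['i * _]mulrC -scalerA gZ.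
  rewrite scalerA (gC a) (gC ('i * a)); case: a => a b; apply/eqP.
  by rewrite eq_complex; apply/andP; split; apply/eqP => /=; ring.
have psilin' : linear (psi : V -> R[i]^o) := psilin.
have psi_le v : `|psi v| <= `|v|.
  have [->|z0] := eqVneq (psi v) 0; first by rewrite normr0.
  pose u := `|psi v| / psi v.
  have u1 : `|u| = 1 by rewrite normrM normfV normr_id divff ?normr_eq0.
  have psiu : psi (u *: v) = `|psi v|.
    by rewrite (linear_mapZ psilin') -[u *: _]/(u * _) divfK.
  have := g_le (u *: v); rewrite /p normrZ u1 mul1r -lecR -normE.
  apply: le_trans; rewrite -[g _]/(complex.Re (psi (u *: v))) psiu.
  by rewrite RRe_real// ger0_real.
exists psi; split=> // x.
have gj y : g (j y) = complex.Re (phi y).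
  by rewrite (gG (j y, complex.Re (phi y)))//; exists y.
rewrite /psi -(linear_mapZ jlin) !gj (linear_mapZ philin').
rewrite -['i *: _]/('i * _) ReM /= mul0r mul1r sub0r opprK.
by case: (phi x).
Qed.

End complex_functional_extension.

(** When [j] is isometric this extends a functional from the subspace [j(E)]. *)
Lemma functional_extension (R : realType) (s : scalars)
    (E V : normedModType (scalarField R s)) (j : E -> V)
    (phi : E -> scalar_banach R s) : linear j -> linear phi ->
  (forall x, `|phi x| <= `|j x|) ->
  exists psi : V -> scalar_banach R s, [/\ linear psi,
    forall v, `|psi v| <= `|v| & forall x, psi (j x) = phi x].
Proof.
case: s E V j phi => /= E V j phi.
- exact: real_functional_extension.
- exact: complex_functional_extension.
Qed.

(** * Least Lipschitz constants and operator norms *)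

Section least_constants.
Variables (R : realType) (s : scalars).
Local Notation K := (scalarField R s).
Local Notation B := (scalar_banach R s).
Local Notation Ban := (completeNormedModType K).

Lemma lip_attained (X Y : metricType K) (f : X -> Y) : lip_bounds f !=set0 ->
  lip_bounds f (lip f) /\ lbound (lip_bounds f) (lip f).
Proof.
move=> fN0; apply: least_attained => // [C []//|C C0 fC]; split=> // x y.
apply: ler_mul_addgt0 => [|e e0]; first exact: mdist_ge0.
have [D [_ fD] DC] := fC e e0.
by rewrite (le_trans (fD x y))// ler_wpM2r// mdist_ge0.
Qed.

Lemma lip_ge0 (X Y : pointedMetricType K) (f : X -> Y) : lip0 f -> 0 <= lip f.
Proof. by move=> [_ /lip_attained[[]]]. Qed.

Lemma lipP (X Y : pointedMetricType K) (f : X -> Y) x y :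
  lip0 f -> mdist (f x) (f y) <= lip f * mdist x y.
Proof. by move=> [_ /lip_attained[[_ +] _]]; apply. Qed.

Lemma lip_le (X Y : metricType K) (f : X -> Y) C : 0 <= C ->
  (forall x y, mdist (f x) (f y) <= C * mdist x y) -> lip f <= C.
Proof. by move=> C0 fC; apply: (lip_attained _).2; first exists C. Qed.

Lemma lip0_id (X : pointedMetricType K) : lip0 (@idfun X).
Proof. by split=> //; exists 1; split=> // x y; rewrite mul1r. Qed.

Lemma lip_id_le1 (X : pointedMetricType K) : lip (@idfun X) <= 1.
Proof. by apply: lip_le => // x y; rewrite mul1r. Qed.

Lemma opnorm_ge0 (E : Ban) (F : normedModType K) (w : E -> F) :
  bounded_op w -> 0 <= opnorm w.
Proof. by move=> [_ /opnorm_least[[]]]. Qed.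

Lemma opnormP (E : Ban) (F : normedModType K) (w : E -> F) x :
  bounded_op w -> `|w x| <= opnorm w * `|x|.
Proof. by move=> [_ /opnorm_least[[_ +] _]]; apply. Qed.

Lemma opnorm_le (E : Ban) (F : normedModType K) (w : E -> F) C : 0 <= C ->
  (forall x, `|w x| <= C * `|x|) -> opnorm w <= C.
Proof. by move=> C0 wC; apply: (opnorm_least _).2; first exists C. Qed.

Lemma bounded_op_le (E F : Ban) (w : E -> F) C : 0 <= C -> linear w ->
  (forall x, `|w x| <= C * `|x|) -> bounded_op w.
Proof. by move=> C0 wlin wC; split=> //; exists C. Qed.

Lemma blip_attained (X1 X2 : metricType K) (E : normedModType K)
    (T : X1 * X2 -> E) : blip_bounds T !=set0 ->
  blip_bounds T (blip T) /\ lbound (blip_bounds T) (blip T).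
Proof.
move=> TN0; apply: least_attained => // [C []//|C C0 TC]; split=> // x x' y y'.
rewrite -mulrA; apply: ler_mul_addgt0 => [|e e0].
  by rewrite mulr_ge0 ?mdist_ge0.
have [D [_ TD] DC] := TC e e0.
rewrite (le_trans (TD x x' y y'))// -mulrA ler_wpM2r//.
by rewrite mulr_ge0 ?mdist_ge0.
Qed.

Lemma blip_le (X1 X2 : metricType K) (E : normedModType K)
  (T : X1 * X2 -> E) C : blip_bounds T C -> blip T <= C.
Proof. by move=> TC; apply: (blip_attained _).2; first exists C. Qed.

Lemma ell_infty_norm_ub (I : Type) (f : ell_infty R s I) i : `|f i| <= `|f|.
Proof. by have /asboolP/supnorm_least[[_ +] _] := valP f; apply. Qed.

Lemma ell_infty_norm_le (I : Type) (f : ell_infty R s I) C : 0 <= C ->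
  (forall i, `|f i| <= C) -> `|f| <= C.
Proof. by move=> C0 fC; have /asboolP/supnorm_least[_] := valP f; apply. Qed.

End least_constants.

(** * The embedding into l_infty and its universal property *)

Section embedding.
Variables (R : realType) (s : scalars).
Local Notation K := (scalarField R s).
Local Notation B := (scalar_banach R s).
Local Notation Ban := (completeNormedModType K).

Lemma dual_ball_norm_le (E : Ban) (phi : dual_ball E) y : `|phi y| <= `|y|.
Proof.
rewrite (le_trans (opnormP _ (dual_ball_op phi)))//.
by rewrite ler_piMl// dual_ball_le1.
Qed.

Lemma dual_ball_intro (E : Ban) (phi : E -> B) : linear phi ->
  (forall y, `|phi y| <= `|y|) ->
  exists psi : dual_ball E, psi = phi :> (E -> B).
Proof.
move=> philin phi1.
have phi1' y : `|phi y| <= 1 * `|y| by rewrite mul1r.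
have phib := bounded_op_le ler01 philin phi1'.
by exists (DualBall phib (opnorm_le ler01 phi1')).
Qed.

Lemma embed_linear (E : Ban) : linear (@embed R s E).
Proof.
move=> a x y; apply: val_inj; apply/funext => phi /=.
by have [philin _] := dual_ball_op phi; exact: philin.
Qed.

(** The functional [a y |-> a |y|] on the line through [y] extends to [E]. *)
Lemma norming_functional (E : Ban) (y : E) :
  exists phi : dual_ball E, phi y = `|y|.
Proof.
pose j (a : B) : E := (a : K) *: y.
have jlin : linear j.
  by move=> a b c; rewrite /j scalerDl scalerA.
have hlin : linear (fun a : B => (a : K) *: (`|y| : B)).
  by move=> a b c; rewrite scalerDl scalerA.
have [|psi [psilin psi_le psij]] := functional_extension jlin hlin.
  by move=> a; rewrite /j !normrZ; rewrite [X in _ * X <= _](normr_id y).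
have [phi phiE] := dual_ball_intro psilin psi_le.
by exists phi; rewrite phiE -[y in LHS]scale1r (psij 1) scale1r.
Qed.

Lemma embed_norm (E : Ban) (y : E) : `|embed y| = `|y|.
Proof.
apply/eqP; rewrite eq_le; apply/andP; split.
  by apply: ell_infty_norm_le => // phi; exact: dual_ball_norm_le.
have [phi phiy] := norming_functional y.
by rewrite -[leLHS]normr_id -phiy; exact: (ell_infty_norm_ub (embed y) phi).
Qed.

Lemma embed_bounded (E : Ban) : bounded_op (@embed R s E).
Proof.
apply: (bounded_op_le ler01) => [|y]; first exact: embed_linear.
by rewrite embed_norm mul1r.
Qed.

(** l_infty is an injective space: a map into it is a family of functionals, and
    each of them extends separately. *)
Lemma embed_factorization (E V : Ban) (j : E -> V) : linear j ->
  (forall x, `|x| <= `|j x|) ->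
  exists w : V -> ell_infty R s (dual_ball E),
    [/\ bounded_op w, opnorm w <= 1 & forall x, w (j x) = embed x].
Proof.
move=> jlin jge.
have ext (phi : dual_ball E) : exists psi : V -> B, [/\ linear psi,
    forall v, `|psi v| <= `|v| & forall x, psi (j x) = phi x].
  have [philin _] := dual_ball_op phi.
  apply: functional_extension => // x.
  exact: le_trans (dual_ball_norm_le _ _) (jge x).
have [Psi PsiP] := choice ext.
have Psi_in v : (fun phi => Psi phi v) \in @ell_infty_pred R s (dual_ball E).
  apply/asboolP; exists `|v|; split=> // phi.
  by have [_ + _] := PsiP phi; apply.
pose w v := MkEllInfty (Psi_in v).
have w_le v : `|w v| <= 1 * `|v|.
  rewrite mul1r; apply: ell_infty_norm_le => // phi.
  by have [_ + _] := PsiP phi; apply.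
exists w; split; last first.
- move=> x; apply: val_inj; apply/funext => phi.
  by have [_ _] := PsiP phi; apply.
- exact: opnorm_le.
- apply: (bounded_op_le ler01 _ w_le) => a u v.
  apply: val_inj; apply/funext => phi.
  by have [+ _ _] := PsiP phi; apply.
Qed.

End embedding.

(** * Injective ideals and arbitrary isometries *)

Section injective_ideals.
Variables (R : realType) (s : scalars).
Local Notation K := (scalarField R s).
Local Notation Metr := (pointedMetricType K).
Local Notation Ban := (completeNormedModType K).
Variables (I : lip_class R s) (N : lip_norm R s).

Lemma lip_ideal_postcomp (X : Metr) (E F : Ban) (T : X -> E) (w : E -> F) :
  lip_ideal I -> I T -> bounded_op w -> I (w \o T).
Proof. by move=> idI IT wb; exact: (lip_ideal_comp idI (lip0_id X) IT wb). Qed.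

(** Injectivity, which speaks of [J_E], holds for every [j] bounded below by 1
    because [J_E] factors through [j]. *)
Lemma lip_injective_isometry (X : Metr) (E F : Ban) (T : X -> E) (j : E -> F) :
  lip_ideal I -> lip_injective I -> lip0 (T : X -> at0 E) -> linear j ->
  (forall x, `|x| <= `|j x|) -> I (j \o T) -> I T.
Proof.
move=> idI injI T0 jlin jge IjT.
have [w [wb _ wj]] := embed_factorization jlin jge.
rewrite injI; split=> //.
have -> : @embed R s E \o T = w \o (j \o T) by apply/funext => x /=.
exact: lip_ideal_postcomp.
Qed.

Lemma normed_lip_postcomp (X : Metr) (E F : Ban) (T : X -> E) (w : E -> F) :
  normed_lip_ideal I N -> I T -> bounded_op w ->
  N (w \o T) <= opnorm w * N T.
Proof.
move=> nI IT wb; rewrite mulrC.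
apply: le_trans (normed_lip_ideal_comp nI (lip0_id X) IT wb) _.
rewrite ler_wpM2r ?opnorm_ge0// ler_piMl ?lip_id_le1//.
exact: normed_lip_ideal_ge0 nI _ _ _ IT.
Qed.

Lemma normed_lip_contraction (X : Metr) (E F : Ban) (T : X -> E) (w : E -> F) :
  normed_lip_ideal I N -> I T -> bounded_op w -> opnorm w <= 1 ->
  N (w \o T) <= N T.
Proof.
move=> nI IT wb w1; apply: le_trans (normed_lip_postcomp nI IT wb) _.
by rewrite ler_piMl//; exact: normed_lip_ideal_ge0 nI _ _ _ IT.
Qed.

(** [j \o T] and [J_E \o T] are obtained from [T] and [j \o T] by composing with
    contractions, so [N (j \o T)] lies between [N (J_E \o T)] and [N T], which
    injectivity makes equal. *)
Lemma normed_lip_injective_isometry (X : Metr) (E F : Ban) (T : X -> E)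
    (j : E -> F) :
  normed_lip_ideal I N -> normed_lip_injective I N -> linear j ->
  (forall x, `|j x| = `|x|) -> I T -> N T = N (j \o T).
Proof.
move=> nI [_ injN] jlin jiso IT.
have jle x : `|j x| <= 1 * `|x| by rewrite mul1r jiso.
have jb := bounded_op_le ler01 jlin jle.
have IjT := lip_ideal_postcomp (normed_lip_ideal_ideal nI) IT jb.
have [|w [wb w1 wj]] := embed_factorization jlin.
  by move=> x; rewrite jiso.
apply/eqP; rewrite eq_le; apply/andP; split; last first.
  by apply: normed_lip_contraction => //; exact: opnorm_le jle.
rewrite (injN _ _ _ IT) /lip_inj_norm.
have -> : @embed R s E \o T = w \o (j \o T) by apply/funext => x /=.
exact: normed_lip_contraction.
Qed.

End injective_ideals.

(** * Two-Lipschitz maps and their associated maps *)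

Section two_lipschitz_maps.
Variables (R : realType) (s : scalars).
Local Notation K := (scalarField R s).
Local Notation B := (scalar_banach R s).
Local Notation Metr := (pointedMetricType K).
Local Notation Ban := (completeNormedModType K).

Lemma blip0_zero (X1 X2 : Metr) (E : Ban) : blip0 ((fun=> 0) : X1 * X2 -> E).
Proof.
split=> //; exists 0; split=> // x1 x1' x2 x2'.
by rewrite !subr0 addr0 normr0 !mul0r.
Qed.

Lemma blip0_linear (X1 X2 : Metr) (E : Ban) (a : K) (T U : X1 * X2 -> E) :
  blip0 T -> blip0 U -> blip0 (fun x => a *: T x + U x).
Proof.
move=> [T0 T0' [C [C0 TC]]] [U0 U0' [D [D0 UD]]]; split.
- by move=> x; rewrite T0 U0 scaler0 addr0.
- by move=> x; rewrite T0' U0' scaler0 addr0.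
exists (`|a| * C + D); split; first by rewrite addr_ge0// mulr_ge0.
move=> x1 x1' x2 x2'.
set t1 := T _; set u1 := U _; set t2 := T _; set u2 := U _.
set t3 := T _; set u3 := U _; set t4 := T _; set u4 := U _.
have -> : a *: t1 + u1 - (a *: t2 + u2) - (a *: t3 + u3) + (a *: t4 + u4) =
    a *: (t1 - t2 - t3 + t4) + (u1 - u2 - u3 + u4).
  rewrite scalerDr !scalerBr !opprD.
  by rewrite [X in X + _ + _]addrACA [X in X + _]addrACA; exact: addrACA.
rewrite (le_trans (ler_normD _ _))// -mulrA mulrDl lerD//.
  by rewrite normrZ -mulrA ler_wpM2l// mulrA; exact: TC.
by rewrite mulrA; exact: UD.
Qed.

Lemma blip0_rank1 (X1 X2 : Metr) (E : Ban) (e : E) (f1 : X1 -> B)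
    (f2 : X2 -> B) : lip0 (f1 : X1 -> at0 B) -> lip0 (f2 : X2 -> at0 B) ->
  blip0 (fun x => ((f1 x.1 : K) * (f2 x.2 : K)) *: e).
Proof.
move=> f1L f2L.
have f10 : f1 point = 0 by case: f1L.
have f20 : f2 point = 0 by case: f2L.
split=> [x1|x2|]; first by rewrite /= f20 mulr0 scale0r.
  by rewrite /= f10 mul0r scale0r.
exists (lip (f1 : X1 -> at0 B) * lip (f2 : X2 -> at0 B) * `|e|).
split; first by rewrite !mulr_ge0 ?lip_ge0.
move=> x1 x1' x2 x2' /=; rewrite -!scalerBl -scalerDl.
have -> : (f1 x1 : K) * f2 x2 - (f1 x1 : K) * f2 x2' - (f1 x1' : K) * f2 x2
    + (f1 x1' : K) * f2 x2' = ((f1 x1 : K) - f1 x1') * ((f2 x2 : K) - f2 x2').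
  by ring.
rewrite normrZ normrM.
have -> : lip (f1 : X1 -> at0 B) * lip (f2 : X2 -> at0 B) * `|e| *
    mdist x1 x1' * mdist x2 x2' =
  (lip (f1 : X1 -> at0 B) * mdist x1 x1') *
  (lip (f2 : X2 -> at0 B) * mdist x2 x2') * `|e| by ring.
by rewrite ler_wpM2r// ler_pM//; [exact: (lipP _ _ f1L)|exact: (lipP _ _ f2L)].
Qed.

Lemma blip0_comp (Z W X1 X2 : Metr) (E F : Ban) (f1 : Z -> X1) (f2 : W -> X2)
    (T : X1 * X2 -> E) (u : E -> F) :
  lip0 f1 -> lip0 f2 -> blip0 T -> bounded_op u ->
  blip0 (fun z => u (T (f1 z.1, f2 z.2))).
Proof.
move=> f1L f2L [T0 T0' [C [C0 TC]]] ub; have [ulin _] := ub.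
have f10 : f1 point = point by case: f1L.
have f20 : f2 point = point by case: f2L.
split=> [z|w|]; first by rewrite /= f20 T0 (linear_map0 ulin).
  by rewrite /= f10 T0' (linear_map0 ulin).
exists (opnorm u * (C * lip f1 * lip f2)); split.
  by rewrite !mulr_ge0 ?opnorm_ge0 ?lip_ge0.
move=> z z' w w' /=; rewrite -!(linear_mapB ulin) -(linear_mapD ulin).
apply: le_trans (opnormP _ ub) _.
have -> : opnorm u * (C * lip f1 * lip f2) * mdist z z' * mdist w w' =
  opnorm u * (C * ((lip f1 * mdist z z') * (lip f2 * mdist w w'))) by ring.
rewrite ler_wpM2l ?opnorm_ge0// (le_trans (TC _ _ _ _))// -mulrA ler_wpM2l//.
by rewrite ler_pM ?mdist_ge0 ?lipP.
Qed.

Lemma blip0_swap (X1 X2 : Metr) (E : Ban) (T : X1 * X2 -> E) :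
  blip0 T -> blip0 (fun z : X2 * X1 => T (z.2, z.1)).
Proof.
move=> [T0 T0' [C [C0 TC]]]; split=> //; exists C; split=> // x x' y y' /=.
by rewrite [_ - _ - _]addrAC mulrAC; exact: TC.
Qed.

Lemma blip_swap (X1 X2 : Metr) (E : Ban) (T : X1 * X2 -> E) : blip0 T ->
  blip T <= blip (fun z : X2 * X1 => T (z.2, z.1)).
Proof.
move=> /blip0_swap[_ _ /blip_attained[[b0 bP] _]].
apply: blip_le; split=> // x x' y y'.
by have := bP y y' x x'; rewrite /= [_ - _ - _]addrAC mulrAC.
Qed.

Lemma assoc1_eq (X1 X2 : Metr) (E : Ban) (T : X1 * X2 -> E)
    (h : X1 -> Lip0 X2 E) : blip0 T ->
  (forall x1 x2, T (x1, x2) = h x1 x2) -> assoc1 T = h.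
Proof.
move=> Tb Th; apply/funext => x1; apply: val_inj; apply/funext => x2.
by rewrite /= assoc1E.
Qed.

Lemma assoc1_difference (X1 X2 : Metr) (E : Ban) (T : X1 * X2 -> E) x x' y y' :
  blip0 T -> (assoc1 T x - assoc1 T x') y - (assoc1 T x - assoc1 T x') y' =
    T (x, y) - T (x, y') - T (x', y) + T (x', y').
Proof.
move=> Tb; rewrite -!(assoc1E _ _ Tb) /=.
by rewrite opprB [X in _ + X]addrC addrA [X in X + _]addrAC.
Qed.

Lemma assoc1_lip0 (X1 X2 : Metr) (E : Ban) (T : X1 * X2 -> E) : blip0 T ->
  lip0 (assoc1 T : X1 -> at0 (Lip0 X2 E)).
Proof.
move=> Tb; have [T0 T0' [C [C0 TC]]] := Tb; split.
  by apply: val_inj; apply/funext => x2; rewrite /= assoc1E.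
exists C; split=> // x x'; rewrite mdist_at0.
apply: Lip0_norm_le => [|y y']; first by rewrite mulr_ge0 ?mdist_ge0.
by rewrite assoc1_difference.
Qed.

Lemma blip_le_assoc1 (X1 X2 : Metr) (E : Ban) (T : X1 * X2 -> E) : blip0 T ->
  blip T <= lip (assoc1 T : X1 -> at0 (Lip0 X2 E)).
Proof.
move=> Tb; have AL := assoc1_lip0 Tb.
apply: blip_le; split=> [|x x' y y']; first exact: lip_ge0.
rewrite -assoc1_difference// (le_trans (Lip0_normP _ _ _))//.
by rewrite ler_wpM2r ?mdist_ge0//; exact: (lipP x x' AL).
Qed.

(** The operator by which the associated map of [u \o T \o (f1, f2)] factors
    through that of [T], see [assoc1_comp]. *)
Lemma Lip0_operator (X W : Metr) (E F : Ban) (f : W -> X) (u : E -> F) :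
  lip0 f -> bounded_op u ->
  exists U : Lip0 X E -> Lip0 W F, [/\ bounded_op U,
    opnorm U <= opnorm u * lip f & forall g w, U g w = u (g (f w))].
Proof.
move=> fL ub; have [ulin _] := ub.
have c0 : 0 <= opnorm u * lip f by rewrite mulr_ge0 ?opnorm_ge0 ?lip_ge0.
have ugf (g : Lip0 X E) y y' : `|u (g (f y)) - u (g (f y'))| <=
    opnorm u * lip f * `|g| * mdist y y'.
  rewrite -(linear_mapB ulin) (le_trans (opnormP _ ub))// -!mulrA.
  rewrite ler_wpM2l ?opnorm_ge0// (le_trans (Lip0_normP _ _ _))//.
  by rewrite mulrCA ler_wpM2l ?Lip0_norm_ge0// lipP.
have Ug (g : Lip0 X E) : (fun w => u (g (f w))) \in @lip0_pred R s W F.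
  apply/asboolP; split.
    by have [-> _] := fL; rewrite Lip0_point (linear_map0 ulin).
  by exists (opnorm u * lip f * `|g|); split; [rewrite mulr_ge0|exact: ugf].
pose U g := MkLip0 (Ug g).
have U_le g : `|U g| <= opnorm u * lip f * `|g|.
  by apply: Lip0_norm_le; [rewrite mulr_ge0|exact: ugf].
exists U; split=> //; last exact: opnorm_le.
apply: (bounded_op_le c0 _ U_le) => a g h; apply: val_inj; apply/funext => w.
exact: ulin.
Qed.

Lemma Lip0_isometry (X : Metr) (E F : Ban) (j : E -> F) :
  linear j -> (forall y, `|j y| = `|y|) ->
  exists U : Lip0 X E -> Lip0 X F, [/\ linear U, forall g, `|U g| = `|g| &
    forall g x, U g x = j (g x)].
Proof.
move=> jlin jiso.
have j_le y : `|j y| <= 1 * `|y| by rewrite mul1r jiso.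
have [U [[Ulin _] _ UE]] :=
  Lip0_operator (lip0_id X) (bounded_op_le ler01 jlin j_le).
have normB (g : Lip0 X E) x y : `|U g x - U g y| = `|g x - g y|.
  by rewrite !UE -(linear_mapB jlin) jiso.
exists U; split=> // g; apply/eqP; rewrite eq_le; apply/andP; split.
  by apply: Lip0_norm_le => // x y; rewrite normB Lip0_normP.
by apply: Lip0_norm_le => // x y; rewrite -normB Lip0_normP.
Qed.

End two_lipschitz_maps.

(** * The ideal of maps whose first associated map lies in a given ideal *)

Lemma blip_class_eq (R : realType) (s : scalars) (J J' : blip_class R s) :
  (forall (X1 X2 : pointedMetricType (scalarField R s))
      (E : completeNormedModType (scalarField R s)) (T : X1 * X2 -> E),
    J X1 X2 E T <-> J' X1 X2 E T) -> J = J'.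
Proof.
move=> JJ'; apply: functional_extensionality_dep => X1.
apply: functional_extensionality_dep => X2.
apply: functional_extensionality_dep => E.
by apply/seteqP; split=> T /JJ'.
Qed.

Lemma blip_injectiveP (R : realType) (s : scalars) (J : blip_class R s) :
  blip_injective J ->
  forall (X1 X2 : pointedMetricType (scalarField R s))
    (E : completeNormedModType (scalarField R s)) (T : X1 * X2 -> E),
  J X1 X2 E T <-> blip_inj_hull J T.
Proof. by move=> injJ X1 X2 E T; rewrite {1}injJ. Qed.

Section left_class.
Variables (R : realType) (s : scalars).
Local Notation K := (scalarField R s).
Local Notation B := (scalar_banach R s).
Local Notation Metr := (pointedMetricType K).
Local Notation Ban := (completeNormedModType K).

(** The half of [bracket] that concerns the first associated map; the other half
    is obtained from it by [swap_class]. *)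
Definition left_class (I : lip_class R s) : blip_class R s := fun X1 X2 E =>
  [set T | blip0 T /\ I X1 (Lip0 X2 E) (assoc1 T)].

Definition left_norm (N : lip_norm R s) : blip_norm R s := fun X1 X2 E T =>
  N X1 (Lip0 X2 E) (assoc1 T).

Lemma assoc1_comp (Z W X1 X2 : Metr) (E F : Ban) (f1 : Z -> X1) (f2 : W -> X2)
    (T : X1 * X2 -> E) (u : E -> F) :
  lip0 f1 -> lip0 f2 -> blip0 T -> bounded_op u ->
  exists U : Lip0 X2 E -> Lip0 W F, [/\ bounded_op U,
    opnorm U <= opnorm u * lip f2 &
    assoc1 (fun z => u (T (f1 z.1, f2 z.2))) = U \o assoc1 T \o f1].
Proof.
move=> f1L f2L Tb ub; have [U [Ub U_le UE]] := Lip0_operator f2L ub.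
exists U; split=> //; apply: assoc1_eq => [|z w]; first
  exact: (blip0_comp f1L f2L Tb ub).
by rewrite /= UE assoc1E.
Qed.

Lemma left_class_ideal (I : lip_class R s) :
  lip_ideal I -> blip_ideal (left_class I).
Proof.
move=> idI; split.
- by move=> X1 X2 E T [].
- move=> X1 X2 E; split; first exact: blip0_zero.
  rewrite (@assoc1_eq _ _ _ _ _ _ (fun=> 0))//; last exact: blip0_zero.
  exact: lip_ideal_zero.
- move=> X1 X2 E a T U [Tb IT] [Ub IU].
  have TUb := blip0_linear a Tb Ub; split=> //.
  rewrite (assoc1_eq (h := fun x => a *: assoc1 T x + assoc1 U x))//.
    exact: lip_ideal_linear.
  by move=> x1 x2; rewrite -(assoc1E _ _ Tb) -(assoc1E _ _ Ub).
- move=> X1 X2 E e f1 f2 f1L f2L.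
  have Tb := blip0_rank1 e f1L f2L; split=> //.
  have [f20 _] := f2L.
  have vL : (fun x => (f2 x : K) *: e) \in @lip0_pred R s X2 E.
    apply/asboolP; split; first by rewrite f20; exact: scale0r.
    exists (lip (f2 : X2 -> at0 B) * `|e|).
    split; first by rewrite mulr_ge0 ?lip_ge0.
    move=> x y; rewrite mdist_at0 -scalerBl normrZ mulrAC ler_wpM2r//.
    exact: (lipP x y f2L).
  rewrite (assoc1_eq (h := fun x => (f1 x : K) *: MkLip0 vL))//.
    exact: lip_ideal_rank1.
  by move=> x1 x2; rewrite /= -scalerA.
- move=> Z W X1 X2 E F f1 f2 T u f1L f2L [Tb IT] ub.
  split; first exact: (blip0_comp f1L f2L Tb ub).
  have [U [Ub _ ->]] := assoc1_comp f1L f2L Tb ub.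
  exact: lip_ideal_comp.
Qed.

Lemma blip_ideal_sub_hull (J : blip_class R s) : blip_ideal J ->
  forall (X1 X2 : Metr) (E : Ban) (T : X1 * X2 -> E),
  J X1 X2 E T -> blip_inj_hull J T.
Proof.
move=> idJ X1 X2 E T JT; split; first exact: (blip_ideal_blip0 idJ).
have := blip_ideal_comp idJ (lip0_id X1) (lip0_id X2) JT (embed_bounded E).
by congr (J _ _ _ _); apply/funext => -[].
Qed.

(** This reduces the injectivity of [left_class I] to that of [I]. *)
Lemma assoc1_embed (X1 X2 : Metr) (E : Ban) (T : X1 * X2 -> E) : blip0 T ->
  exists U : Lip0 X2 E -> Lip0 X2 (ell_infty R s (dual_ball E)),
    [/\ linear U, forall g, `|U g| = `|g| &
      assoc1 (@embed R s E \o T) = U \o assoc1 T].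
Proof.
move=> Tb; have [U [Ulin Uiso UE]] :=
  Lip0_isometry X2 (@embed_linear R s E) (@embed_norm R s E).
exists U; split=> //; apply: assoc1_eq => [|x1 x2]; last first.
  by rewrite /= UE assoc1E.
have := blip0_comp (lip0_id X1) (lip0_id X2) Tb (embed_bounded E).
by congr blip0; apply/funext => -[].
Qed.

Lemma left_class_injective (I : lip_class R s) :
  lip_ideal I -> lip_injective I -> blip_injective (left_class I).
Proof.
move=> idI injI; apply: blip_class_eq => X1 X2 E T; split.
  by apply: blip_ideal_sub_hull; exact: left_class_ideal.
move=> [Tb [_]]; have [U [Ulin Uiso ->]] := assoc1_embed Tb.
move=> IUT; split=> //.
apply: (lip_injective_isometry idI injI (assoc1_lip0 Tb) Ulin _ IUT).
by move=> g; rewrite Uiso.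
Qed.

Lemma left_class_normed (I : lip_class R s) (N : lip_norm R s) :
  normed_lip_ideal I N -> normed_blip_ideal (left_class I) (left_norm N).
Proof.
move=> nI; have idI := normed_lip_ideal_ideal nI.
split; first exact: left_class_ideal.
- by move=> X1 X2 E T [_]; exact: normed_lip_ideal_ge0.
- move=> X1 X2 E T [Tb IT] /(normed_lip_ideal_eq0 nI IT) A0.
  by apply/funext => -[x1 x2]; rewrite -(assoc1E _ _ Tb) A0.
- move=> X1 X2 E a T [Tb IT]; rewrite /left_norm -(normed_lip_idealZ nI)//.
  congr (N _ _ _); apply: assoc1_eq.
    have := blip0_linear a Tb (blip0_zero X1 X2 E).
    by congr blip0; apply/funext => x; rewrite addr0.
  by move=> x1 x2; rewrite -(assoc1E _ _ Tb).
- move=> X1 X2 E T U [Tb IT] [Ub IU]; rewrite /left_norm.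
  have -> : assoc1 (fun x => T x + U x) = (fun x => assoc1 T x + assoc1 U x).
    apply: assoc1_eq => [|x1 x2]; last first.
      by rewrite -(assoc1E _ _ Tb) -(assoc1E _ _ Ub).
    have := blip0_linear 1 Tb Ub.
    by congr blip0; apply/funext => x; rewrite scale1r.
  exact: (normed_lip_idealD nI IT IU).
- move=> X1 X2 E T [Tb IT]; apply: le_trans (blip_le_assoc1 Tb) _.
  exact: (normed_lip_ideal_lip nI IT).
- rewrite /left_norm; pose m (x : at0 B * at0 B) : B := (x.1 : K) * (x.2 : K).
  have idL := lip0_id (at0 B : Metr).
  have mb : blip0 m.
    have := blip0_rank1 (1 : B) idL idL.
    by congr blip0; apply/funext => x; exact: mulr1.
  have mE x y : assoc1 m x y = (x : K) * (y : K) by rewrite assoc1E.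
  have m_norm x : `|assoc1 m x| = `|x : B|.
    apply/eqP; rewrite eq_le; apply/andP; split.
      apply: Lip0_norm_le => // y z; rewrite !mE -mulrBr.
      by rewrite [`|_|]normrM.
    have := Lip0_normP (assoc1 m x) (1 : B) (0 : B).
    rewrite !mE mulr1 mulr0 subr0 mdist_at0 subr0.
    by rewrite [`|1|]normr1 mulr1.
  have mlin : linear (assoc1 m : B -> Lip0 (at0 B) B).
    move=> a x y; apply: val_inj; apply/funext => z.
    rewrite /= mE [LHS]mulrDl; congr (_ + _); last by rewrite mE.
    by rewrite -[RHS]/(a *: assoc1 m x z) mE; exact: esym (mulrA _ _ _).
  have m_le (x : B) : `|assoc1 m x| <= 1 * `|x| by rewrite mul1r m_norm.
  (* The associated map of the multiplication is an isometry composed with the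
     identity of the scalar field, whose norm is 1; this bounds the norm from
     above, and the Lipschitz constant bounds it from below. *)
  have IB : I (at0 B) B (id : at0 B -> B).
    have := lip_ideal_rank1 idI (1 : B) idL.
    by congr (I _ _ _); apply/funext => x; exact: mulr1.
  have mop := bounded_op_le ler01 mlin m_le.
  apply/eqP; rewrite eq_le; apply/andP; split.
    rewrite -(normed_lip_ideal_id nI).
    exact: (normed_lip_contraction nI IB mop (opnorm_le ler01 m_le)).
  have IM : I (at0 B) (Lip0 (at0 B) B) (assoc1 m).
    exact: (lip_ideal_postcomp idI IB mop).
  apply: le_trans (normed_lip_ideal_lip nI IM).
  have := @lipP R s (at0 B) _ _ (1 : B) (0 : B) (assoc1_lip0 mb).
  rewrite !mdist_at0 (linear_map0 mlin) !subr0 m_norm.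
  by rewrite [`|1|]normr1 mulr1.
- move=> Z W X1 X2 E F f1 f2 T u f1L f2L [Tb IT] ub; rewrite /left_norm.
  have [U [Ub U_le ->]] := assoc1_comp f1L f2L Tb ub.
  apply: le_trans (normed_lip_ideal_comp nI f1L IT Ub) _.
  have N0 := normed_lip_ideal_ge0 nI IT.
  apply: le_trans (ler_wpM2l _ U_le) _.
    by rewrite mulr_ge0// lip_ge0.
  by rewrite le_eqVlt; apply/orP; left; apply/eqP; ring.
Qed.

Lemma left_class_normed_injective (I : lip_class R s) (N : lip_norm R s) :
  normed_lip_ideal I N -> normed_lip_injective I N ->
  normed_blip_injective (left_class I) (left_norm N).
Proof.
move=> nI injN; have [injI _] := injN.
split; first exact: (left_class_injective (normed_lip_ideal_ideal nI)).
move=> X1 X2 E T [Tb IT]; rewrite /blip_inj_norm /left_norm.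
have [U [Ulin Uiso ->]] := assoc1_embed Tb.
exact: (normed_lip_injective_isometry nI injN Ulin Uiso IT).
Qed.

End left_class.

(** * Exchanging variables and intersecting *)

Section swap_class.
Variables (R : realType) (s : scalars) (J : blip_class R s) (N : blip_norm R s).

Definition swap_class : blip_class R s := fun X1 X2 E =>
  [set T | @J X2 X1 E (fun z => T (z.2, z.1))].

Definition swap_norm : blip_norm R s := fun X1 X2 E T =>
  @N X2 X1 E (fun z => T (z.2, z.1)).

Lemma blip0_swapE (X1 X2 : pointedMetricType (scalarField R s))
    (E : completeNormedModType (scalarField R s)) (T : X1 * X2 -> E) :
  blip0 (fun z : X2 * X1 => T (z.2, z.1)) -> blip0 T.
Proof. by move=> /blip0_swap; congr blip0; apply/funext => -[]. Qed.

Lemma swap_class_ideal : blip_ideal J -> blip_ideal swap_class.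
Proof.
move=> idJ; split.
- by move=> X1 X2 E T /(blip_ideal_blip0 idJ)/blip0_swapE.
- by move=> X1 X2 E; exact: (blip_ideal_zero idJ X2 X1 E).
- by move=> X1 X2 E a T U JT JU; exact: (blip_ideal_linear idJ a JT JU).
- move=> X1 X2 E e f1 f2 f1L f2L.
  have := blip_ideal_rank1 idJ e f2L f1L.
  by congr (J _); apply/funext => x; rewrite mulrC.
- move=> Z W X1 X2 E F f1 f2 T u f1L f2L JT ub.
  exact: (blip_ideal_comp idJ f2L f1L JT ub).
Qed.

Lemma swap_class_injective : blip_injective J -> blip_injective swap_class.
Proof.
move=> injJ; apply: blip_class_eq => X1 X2 E T; split.
  by move=> /(blip_injectiveP injJ)[/blip0_swapE Tb JT]; split.
by move=> [Tb JT]; apply/(blip_injectiveP injJ); split; first exact: blip0_swap.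
Qed.

Lemma swap_class_normed :
  normed_blip_ideal J N -> normed_blip_ideal swap_class swap_norm.
Proof.
move=> nJ; have idJ := normed_blip_ideal_ideal nJ.
split; first exact: swap_class_ideal.
- by move=> X1 X2 E T JT; exact: (normed_blip_ideal_ge0 nJ JT).
- move=> X1 X2 E T JT /(normed_blip_ideal_eq0 nJ JT) T0.
  by apply/funext => -[x1 x2]; exact: (congr1 (fun f => f (x2, x1)) T0).
- by move=> X1 X2 E a T JT; exact: (normed_blip_idealZ nJ a JT).
- by move=> X1 X2 E T U JT JU; exact: (normed_blip_idealD nJ JT JU).
- move=> X1 X2 E T JT; apply: le_trans (normed_blip_ideal_blip nJ JT).
  by apply: blip_swap; apply: blip0_swapE; exact: (blip_ideal_blip0 idJ).
- rewrite -(normed_blip_ideal_mul nJ); congr (N _).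
  by apply/funext => x; rewrite /= mulrC.
- move=> Z W X1 X2 E F f1 f2 T u f1L f2L JT ub; rewrite mulrAC.
  exact: (normed_blip_ideal_comp nJ f2L f1L JT ub).
Qed.

Lemma swap_class_normed_injective :
  normed_blip_injective J N -> normed_blip_injective swap_class swap_norm.
Proof.
move=> [injJ injN]; split; first exact: swap_class_injective.
by move=> X1 X2 E T JT; exact: injN.
Qed.

End swap_class.

Section meet_class.
Variables (R : realType) (s : scalars).
Local Notation K := (scalarField R s).
Variables (J1 J2 : blip_class R s) (N1 N2 : blip_norm R s).

Definition meet_class : blip_class R s := fun X1 X2 E =>
  @J1 X1 X2 E `&` @J2 X1 X2 E.

Definition max_norm : blip_norm R s := fun X1 X2 E T =>
  Num.max (N1 T) (N2 T).

Lemma meet_class_ideal :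
  blip_ideal J1 -> blip_ideal J2 -> blip_ideal meet_class.
Proof.
move=> id1 id2; split.
- by move=> X1 X2 E T [/(blip_ideal_blip0 id1)].
- by move=> X1 X2 E; split; exact: blip_ideal_zero.
- by move=> X1 X2 E a T U [? ?] [? ?]; split; exact: blip_ideal_linear.
- move=> X1 X2 E e f1 f2 f1L f2L.
  split; first exact: (blip_ideal_rank1 id1 e f1L f2L).
  exact: (blip_ideal_rank1 id2 e f1L f2L).
- move=> Z W X1 X2 E F f1 f2 T u f1L f2L [J1T J2T] ub.
  split; first exact: (blip_ideal_comp id1 f1L f2L J1T ub).
  exact: (blip_ideal_comp id2 f1L f2L J2T ub).
Qed.

Lemma meet_class_injective :
  blip_injective J1 -> blip_injective J2 -> blip_injective meet_class.
Proof.
move=> inj1 inj2; apply: blip_class_eq => X1 X2 E T; split.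
  move=> [/(blip_injectiveP inj1)[Tb J1T] /(blip_injectiveP inj2)[_ J2T]].
  by split=> //; split.
move=> [Tb [J1T J2T]].
by split; [apply/(blip_injectiveP inj1)|apply/(blip_injectiveP inj2)]; split.
Qed.

(** The scalar field is only partially ordered in the complex case, so that
    maxima behave well only for comparable elements. *)
Lemma nneg_ge_max (x y z : K) : 0 <= x -> 0 <= y ->
  (Num.max x y <= z) = (x <= z) && (y <= z).
Proof.
move=> x0 y0; apply: comparable_ge_max.
by apply: real_comparable; exact: ger0_real.
Qed.

Lemma meet_class_normed : normed_blip_ideal J1 N1 -> normed_blip_ideal J2 N2 ->
  normed_blip_ideal meet_class max_norm.
Proof.
move=> n1 n2.
have idJ := meet_class_ideal (normed_blip_ideal_ideal n1)
  (normed_blip_ideal_ideal n2).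
have ge01 := normed_blip_ideal_ge0 n1; have ge02 := normed_blip_ideal_ge0 n2.
have max_ub (X1 X2 : pointedMetricType K) (E : completeNormedModType K)
    (T : X1 * X2 -> E) : meet_class T ->
    (N1 T <= max_norm T) && (N2 T <= max_norm T).
  by move=> [J1T J2T]; rewrite -nneg_ge_max ?ge01 ?ge02.
split.
- exact: idJ.
- move=> X1 X2 E T JT; have /andP[+ _] := max_ub _ _ _ _ JT.
  by apply: le_trans; apply: ge01; case: JT.
- move=> X1 X2 E T JT max0; have /andP[+ _] := max_ub _ _ _ _ JT.
  have [J1T _] := JT; rewrite max0 => N1le.
  by apply: (normed_blip_ideal_eq0 n1 J1T); apply/eqP; rewrite eq_le N1le ge01.
- move=> X1 X2 E a T [J1T J2T]; rewrite /max_norm.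
  by rewrite (normed_blip_idealZ n1)// (normed_blip_idealZ n2)// -maxr_pMr.
- move=> X1 X2 E T U JT JU; have [J1T J2T] := JT; have [J1U J2U] := JU.
  have [J1TU J2TU] : meet_class (fun x => T x + U x).
    have := blip_ideal_linear idJ 1 JT JU.
    by congr (meet_class _); apply/funext => x; rewrite scale1r.
  rewrite nneg_ge_max ?ge01 ?ge02//.
  have /andP[T1 T2] := max_ub _ _ _ _ JT.
  have /andP[U1 U2] := max_ub _ _ _ _ JU.
  apply/andP; split.
    by apply: le_trans (normed_blip_idealD n1 J1T J1U) _; exact: lerD.
  by apply: le_trans (normed_blip_idealD n2 J2T J2U) _; exact: lerD.
- move=> X1 X2 E T JT; have /andP[+ _] := max_ub _ _ _ _ JT.
  by apply: le_trans; apply: (normed_blip_ideal_blip n1); case: JT.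
- rewrite /max_norm (normed_blip_ideal_mul n1) (normed_blip_ideal_mul n2).
  exact: maxxx.
- move=> Z W X1 X2 E F f1 f2 T u f1L f2L JT ub; have [J1T J2T] := JT.
  have /andP[T1 T2] := max_ub _ _ _ _ JT.
  have bound_le c : c <= max_norm T ->
      opnorm u * c * lip f1 * lip f2 <= opnorm u * max_norm T * lip f1 * lip f2.
    by move=> cm; rewrite !ler_wpM2r ?lip_ge0// ler_wpM2l ?opnorm_ge0.
  have [J1C J2C] := blip_ideal_comp idJ f1L f2L JT ub.
  rewrite nneg_ge_max ?ge01 ?ge02//; apply/andP; split.
    exact: le_trans (normed_blip_ideal_comp n1 f1L f2L J1T ub) (bound_le _ T1).
  exact: le_trans (normed_blip_ideal_comp n2 f1L f2L J2T ub) (bound_le _ T2).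
Qed.

Lemma meet_class_normed_injective :
  normed_blip_injective J1 N1 -> normed_blip_injective J2 N2 ->
  normed_blip_injective meet_class max_norm.
Proof.
move=> [inj1 injN1] [inj2 injN2]; split; first exact: meet_class_injective.
by move=> X1 X2 E T [J1T J2T]; rewrite /max_norm injN1// injN2.
Qed.

End meet_class.

(** * The bracket *)

Lemma bracketE (R : realType) (s : scalars) (I1 I2 : lip_class R s) :
  bracket I1 I2 = meet_class (left_class I1) (swap_class (left_class I2)).
Proof.
apply: blip_class_eq => X1 X2 E T; split.
  (* [assoc1] of [T] with exchanged variables unfolds to [assoc2 T]. *)
  by move=> [Tb I1T I2T]; split; split=> //; exact: blip0_swap.
by move=> [[Tb I1T] [_ I2T]].
Qed.

Lemma bracket_normE (R : realType) (s : scalars) (N1 N2 : lip_norm R s) :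
  bracket_norm N1 N2 = max_norm (left_norm N1) (swap_norm (left_norm N2)).
Proof. by []. Qed.

Theorem corollary5p6 (R : realType) (s : scalars) (I1 I2 : lip_class R s) :
  (lip_ideal I1 -> lip_injective I1 ->
   lip_ideal I2 -> lip_injective I2 ->
   blip_ideal (bracket I1 I2) /\ blip_injective (bracket I1 I2))
  /\
  (forall N1 N2 : lip_norm R s,
   normed_lip_ideal I1 N1 -> normed_lip_injective I1 N1 ->
   normed_lip_ideal I2 N2 -> normed_lip_injective I2 N2 ->
   normed_blip_ideal (bracket I1 I2) (bracket_norm N1 N2) /\
   normed_blip_injective (bracket I1 I2) (bracket_norm N1 N2)).
Proof.
rewrite bracketE; split=> [id1 inj1 id2 inj2|N1 N2 n1 inj1 n2 inj2].
  split.
    by apply: meet_class_ideal; last apply: swap_class_ideal;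
      exact: left_class_ideal.
  by apply: meet_class_injective; last apply: swap_class_injective;
    exact: left_class_injective.
rewrite bracket_normE; split.
  by apply: meet_class_normed; last apply: swap_class_normed;
    exact: left_class_normed.
by apply: meet_class_normed_injective; last apply: swap_class_normed_injective;
  exact: left_class_normed_injective.
Qed.
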